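(* Let $G$ be a cubic (i.e. $3$-regular) graph, let $q\ge 2$ be an integer, and let $\beta>0$ be real. Then \[ U^q_{K_{3,3}}(\beta) \le U^q_G(\beta) \le U^q_{K_{4}}(\beta). \] Furthermore, equality holds in the first inequality if and only if $G$ is a disjoint union of copies of $K_{3,3}$, and equality holds in the second inequality if and only if $G$ is a disjoint union of copies of $K_4$. As a consequence, \[ F^q_{K_4}(\beta) \le F^q_G(\beta) \le F^q_{K_{3,3}}(\beta). \]
   Context: Graphs are finite, simple and non-empty. For a graph $G$, an integer $q\ge 2$, and a (not necessarily proper) coloring $\sigma\in[q]^{V(G)}$ of the vertices, where $[q]=\{1,\dots,q\}$, let $m(\sigma)$ be the number of monochromatic edges of $G$ under $\sigma$ (edges whose two endpoints receive the same color). The $q$-color Potts model partition function at inverse temperature $\beta\in\mathbb{R}$ is \[ Z_G^q(\beta)=\sum_{\sigma\in[q]^{V(G)}} e^{-\beta m(\sigma)}. \] The internal energy per particle is \[ U^q_G(\beta) = -\frac{1}{|V(G)|}\frac{d}{d\beta}\log Z_G^q(\beta)=\frac{1}{|V(G)|}\,\frac{\sum_{\sigma\in[q]^{V(G)}} m(\sigma)e^{-\beta m(\sigma)}}{Z_G^q(\beta)}, \] and the free energy per particle is \[ F^q_G(\beta)=\frac{1}{|V(G)|}\log Z_G^q(\beta). \] $K_{3,3}$ is the complete bipartite graph with parts of size $3$, and $K_4$ is the complete graph on $4$ vertices. *)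

(* Defs.v *)
From HB Require Import structures.
From mathcomp Require Import all_boot all_order all_algebra.
From mathcomp Require Import boolp classical_sets functions reals topology normedtype
  sequences derive realfun exp.

Set Implicit Arguments.
Unset Strict Implicit.
Unset Printing Implicit Defensive.

Import Order.TTheory GRing.Theory Num.Theory.
Import numFieldNormedType.Exports.

Local Open Scope ring_scope.

(* The vertex type may be empty here; non-emptiness is a separate hypothesis
   [0 < #|G|]. *)
Record sgraph := SGraph {
  vertex :> finType;
  adj : rel vertex;
  adj_sym : symmetric adj;
  adj_irrefl : irreflexive adj }.

Definition regular (d : nat) (G : sgraph) : Prop :=
  forall v : G, #|[set w | adj v w]| = d.

Definition cubic (G : sgraph) : Prop := regular 3 G.

Definition edges (G : sgraph) : {set {set G}} :=
  [set [set p.1; p.2] | p in [set p : G * G | adj p.1 p.2]].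

Definition isomorphic (G H : sgraph) : Prop :=
  exists2 f : G -> H, bijective f & forall x y, adj (f x) (f y) = adj x y.

Definition complete_adj (n : nat) : rel 'I_n := fun i j => i != j.

Fact complete_adj_sym n : symmetric (@complete_adj n).
Proof. by move=> i j; rewrite /complete_adj eq_sym. Qed.

Fact complete_adj_irrefl n : irreflexive (@complete_adj n).
Proof. by move=> i; rewrite /complete_adj eqxx. Qed.

Definition complete (n : nat) : sgraph :=
  SGraph (@complete_adj_sym n) (@complete_adj_irrefl n).

Definition bipartite_adj (m n : nat) : rel ('I_m + 'I_n)%type :=
  fun x y => match x, y with
             | inl _, inr _ | inr _, inl _ => true
             | _, _ => false
             end.

Fact bipartite_adj_sym m n : symmetric (@bipartite_adj m n).
Proof. by case=> i [] j. Qed.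

Fact bipartite_adj_irrefl m n : irreflexive (@bipartite_adj m n).
Proof. by case. Qed.

Definition complete_bipartite (m n : nat) : sgraph :=
  SGraph (@bipartite_adj_sym m n) (@bipartite_adj_irrefl m n).

Definition copies_adj (k : nat) (H : sgraph) : rel ('I_k * H)%type :=
  fun x y => (x.1 == y.1) && adj x.2 y.2.

Fact copies_adj_sym k H : symmetric (@copies_adj k H).
Proof. by move=> x y; rewrite /copies_adj eq_sym adj_sym. Qed.

Fact copies_adj_irrefl k H : irreflexive (@copies_adj k H).
Proof. by move=> x; rewrite /copies_adj adj_irrefl andbF. Qed.

Definition copies (k : nat) (H : sgraph) : sgraph :=
  SGraph (@copies_adj_sym k H) (@copies_adj_irrefl k H).

Definition disjoint_union_of_copies (H G : sgraph) : Prop :=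
  exists k : nat, isomorphic G (copies k H).

Section Potts.
Variable R : realType.

Definition mono_edges (G : sgraph) (q : nat) (s : {ffun G -> 'I_q}) : nat :=
  #|[set E in edges G | [forall x in E, forall y in E, s x == s y]]|.

Definition potts_Z (q : nat) (G : sgraph) (beta : R) : R :=
  \sum_(s : {ffun G -> 'I_q}) expR (- beta * (mono_edges s)%:R).

Definition internal_energy (q : nat) (G : sgraph) (beta : R) : R :=
  - #|G|%:R^-1 * derive1 (fun b : R => ln (potts_Z q G b)) beta.

Definition free_energy (q : nat) (G : sgraph) (beta : R) : R :=
  #|G|%:R^-1 * ln (potts_Z q G beta).

Lemma potts_Z_gt0 (q : nat) (G : sgraph) (beta : R) :
  (0 < q)%N -> 0 < potts_Z q G beta.
Proof.
move=> q0; rewrite /potts_Z (bigD1 [ffun=> Ordinal q0]) //=.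
by rewrite ltr_pwDl ?expR_gt0 // sumr_ge0 // => s _; apply: expR_ge0.
Qed.

Lemma is_derive_potts_Z (q : nat) (G : sgraph) (beta : R) :
  is_derive beta 1 (potts_Z q G)
    (- \sum_(s : {ffun G -> 'I_q})
        (mono_edges s)%:R * expR (- beta * (mono_edges s)%:R)).
Proof.
rewrite (_ : potts_Z q G = \sum_(s : {ffun G -> 'I_q})
    ((fun b : R => expR (- b * (mono_edges s)%:R)) : R -> R)); last first.
  by apply/funext => b; rewrite fct_sumE.
rewrite -sumrN; elim/big_ind2: _ => [|f df g dg hf hg|s _].
- exact: is_derive_cst.
- exact: is_deriveD.
have h : is_derive beta 1 (fun b : R => - b * (mono_edges s)%:R)
    (- (mono_edges s)%:R).
  rewrite (_ : (fun b : R => _) = - (mono_edges s)%:R \*: (@id R)).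
    by apply: is_derive_eq; rewrite /GRing.scale /= mulr1.
  by apply/funext => b; rewrite /= /GRing.scale /= mulrC mulrN mulNr.
have := @is_derive1_comp R expR _ beta _ _ (is_derive_expR _) h.
by rewrite mulrN [X in - X]mulrC.
Qed.

Lemma internal_energyE (q : nat) (G : sgraph) (beta : R) : (0 < q)%N ->
  internal_energy q G beta =
  #|G|%:R^-1 *
  ((\sum_(s : {ffun G -> 'I_q})
      (mono_edges s)%:R * expR (- beta * (mono_edges s)%:R))
     / potts_Z q G beta).
Proof.
move=> q0; rewrite /internal_energy derive1E.
have hZ := is_derive_potts_Z q G beta.
have hl := is_derive1_ln (potts_Z_gt0 G beta q0).
have [_ ->] := is_derive1_comp hl hZ.
by rewrite mulrN mulNr mulrN opprK [X in _ * X]mulrC.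
Qed.

End Potts.

(* Main.v *)
Require Import Defs.
From Stdlib Require Import ZArith.
From HB Require Import structures.
From mathcomp Require Import all_boot all_order all_algebra.
From mathcomp Require Import ssrZ zify ring.
From mathcomp Require Import functions reals topology normedtype sequences.
From mathcomp Require Import derive realfun exp.

(* For a vertex v, fix the colors outside its closed neighborhood and resample
   the four colors inside. A linear combination, over v and its neighbors, of
   the number of monochromatic edges at a vertex and the indicator that its
   neighborhood is monochromatic then has a conditional mean given by the local
   view alone: the edges inside the neighborhood and the colors seen from it.
   By regularity the indicator terms cancel when summed over v, so a sign of
   all these local means bounds the internal energy, with equality iff every
   occurring view is tight. For the upper bound no indicator term is needed
   and only the view of K_4 is tight. For the lower bound its coefficient is
   the one making the two kinds of views occurring in K_{3,3} (three equal
   pairs of colors aa, or ab) both tight, and no other view is.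

   The local means are polynomials in e^beta and q. Up to symmetry there are
   finitely many views, and after the substitutions e^beta = 1 + x and
   q = max(3, number of colors seen) + y (or q = 2, y = 0) all coefficients are
   nonnegative. *)

Set Implicit Arguments.
Unset Strict Implicit.
Unset Printing Implicit Defensive.

Import Order.TTheory GRing.Theory Num.Theory.
Import numFieldNormedType.Exports.
Local Open Scope ring_scope.
(* ssrint takes over the key of Z_scope. *)
Delimit Scope Z_scope with coqZ.

(** * Bivariate integer polynomials *)

Section DensePoly.
Variable T : Type.
Variables (zero : T) (add mul : T -> T -> T).

Fixpoint dense_add (p q : seq T) : seq T :=
  match p, q with
  | [::], _ => q
  | _, [::] => p
  | a :: p', b :: q' => add a b :: dense_add p' q'
  end.

Fixpoint dense_mul (p q : seq T) : seq T :=
  if p is a :: p' then dense_add (map (mul a) q) (zero :: dense_mul p' q)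
  else [::].

Variables (R : comPzRingType) (x : R) (f : T -> R).

Definition dense_eval (p : seq T) : R := foldr (fun a s => f a + x * s) 0 p.

Hypothesis f0 : f zero = 0.
Hypothesis fD : {morph f : a b / add a b >-> a + b}.
Hypothesis fM : {morph f : a b / mul a b >-> a * b}.

Lemma dense_evalD : {morph dense_eval : p q / dense_add p q >-> p + q}.
Proof.
elim=> [|a p IH] [|b q] /=; rewrite ?add0r ?addr0 // fD IH mulrDr.
by rewrite addrACA.
Qed.

Lemma dense_evalM : {morph dense_eval : p q / dense_mul p q >-> p * q}.
Proof.
elim=> [|a p IH] q /=; first by rewrite mul0r.
rewrite dense_evalD /= f0 add0r IH mulrDl mulrA; congr (_ + _).
elim: q => [|b q IHq] /=; first by rewrite mulr0.
by rewrite fM IHq mulrDr mulrCA.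
Qed.

End DensePoly.

(* [[a_00; a_01; ..]; [a_10; ..]; ..] stands for the sum of the
   a_ij x^i y^j. *)
Definition bipoly := seq (seq Z).

Definition uni_add : seq Z -> seq Z -> seq Z := dense_add Z.add.
Definition uni_mul : seq Z -> seq Z -> seq Z := dense_mul Z0 Z.add Z.mul.
Definition bi_add : bipoly -> bipoly -> bipoly := dense_add uni_add.
Definition bi_mul : bipoly -> bipoly -> bipoly :=
  dense_mul [::] uni_add uni_mul.
Definition bi_const (z : Z) : bipoly := [:: [:: z]].
Definition bi_scale (z : Z) (p : bipoly) : bipoly := map (map (Z.mul z)) p.
Fixpoint bi_exp (p : bipoly) (n : nat) : bipoly :=
  if n is m.+1 then bi_mul p (bi_exp p m) else bi_const 1%coqZ.

Declare Scope bipoly_scope.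
Delimit Scope bipoly_scope with BP.
Bind Scope bipoly_scope with bipoly.
Notation "p + q" := (bi_add p q) : bipoly_scope.
Notation "p * q" := (bi_mul p q) : bipoly_scope.
Notation "p ^ n" := (bi_exp p n) : bipoly_scope.
Notation "p - q" := (bi_add p (bi_scale (-1)%coqZ q)) : bipoly_scope.

Definition bi_nonneg (p : bipoly) := all (all (Z.leb 0)) p.
(** The positive coefficient must belong to a pure power of x: the evaluation points have x > 0, but
    y may be 0. *)
Definition bi_pos (p : bipoly) :=
  bi_nonneg p && has (fun r => Z.ltb 0 (head Z0 r)) p.
Definition bi_zero (p : bipoly) := all (all (Z.eqb 0)) p.

Section BiEval.
Variables (R : comPzRingType) (x y : R).

Definition ringZ (z : Z) : R := (int_of_Z z)%:~R.

Lemma ringZD : {morph ringZ : a b / Z.add a b >-> a + b}.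
Proof.
move=> a b; rewrite /ringZ -rmorphD; congr (_%:~R).
exact: (rmorphD int_of_Z).
Qed.

Lemma ringZM : {morph ringZ : a b / Z.mul a b >-> a * b}.
Proof.
move=> a b; rewrite /ringZ -rmorphM; congr (_%:~R).
exact: (rmorphM int_of_Z).
Qed.

Lemma ringZ_nat n : ringZ (Z.of_nat n) = n%:R.
Proof. by rewrite /ringZ pmulrn; congr (_%:~R); case: n => //= n; lia. Qed.

Definition bi_eval (p : bipoly) : R := dense_eval x (dense_eval y ringZ) p.

Lemma bi_evalD : {morph bi_eval : p q / (p + q)%BP >-> p + q}.
Proof. by apply: dense_evalD; apply: dense_evalD; apply: ringZD. Qed.

Lemma bi_evalM : {morph bi_eval : p q / (p * q)%BP >-> p * q}.
Proof.
apply: dense_evalM => //; first by apply: dense_evalD; apply: ringZD.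
by apply: dense_evalM; [|apply: ringZD|apply: ringZM].
Qed.

Lemma bi_evalC z : bi_eval (bi_const z) = ringZ z.
Proof. by rewrite /bi_eval /= !mulr0 !addr0. Qed.

Lemma bi_evalZ z p : bi_eval (bi_scale z p) = ringZ z * bi_eval p.
Proof.
elim: p => [|r p IH]; first by rewrite mulr0.
rewrite /bi_eval /= in IH *; rewrite IH mulrDr mulrCA; congr (_ + _).
elim: r => [|a r IHr] /=; first by rewrite mulr0.
by rewrite IHr ringZM mulrDr mulrCA.
Qed.

Lemma bi_evalB p q : bi_eval (p - q)%BP = bi_eval p - bi_eval q.
Proof. by rewrite bi_evalD bi_evalZ /ringZ /= mulN1r. Qed.

Lemma bi_evalX p n : bi_eval (p ^ n)%BP = bi_eval p ^+ n.
Proof.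
elim: n => [|n IH]; first exact: bi_evalC.
by rewrite exprS -IH -bi_evalM.
Qed.

Lemma bi_eval_zero p : bi_zero p -> bi_eval p = 0.
Proof.
elim: p => [|r p IH] //= /andP[hr /IH]; rewrite /bi_eval /= => ->.
rewrite mulr0 addr0; elim: r hr => [|a r IHr] //= /andP[ha /IHr ->].
by rewrite mulr0 addr0; case: a ha.
Qed.

End BiEval.

Section BiSign.
Variables (R : realDomainType) (x y : R).
Hypotheses (x_gt0 : 0 < x) (y_ge0 : 0 <= y).

Lemma ringZ_ge0 z : Z.leb 0 z -> 0 <= ringZ R z.
Proof. by move=> hz; rewrite /ringZ ler0z; lia. Qed.

Lemma ringZ_gt0 z : Z.ltb 0 z -> 0 < ringZ R z.
Proof. by move=> hz; rewrite /ringZ ltr0z; lia. Qed.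

Lemma uni_eval_ge0 r : all (Z.leb 0) r -> 0 <= dense_eval y (ringZ R) r.
Proof.
elim: r => [|a r IH] //= /andP[/ringZ_ge0 ha /IH hr].
by rewrite addr_ge0 ?mulr_ge0.
Qed.

Lemma bi_eval_ge0 p : bi_nonneg p -> 0 <= bi_eval x y p.
Proof.
rewrite /bi_eval; elim: p => [|r p IH] //= /andP[/uni_eval_ge0 hr /IH hp].
by rewrite addr_ge0 ?mulr_ge0 // ltW.
Qed.

Lemma bi_eval_gt0 p : bi_pos p -> 0 < bi_eval x y p.
Proof.
case/andP; elim: p => [|r p IH] //= /andP[hr hp] /orP[h|/(IH hp) h].
  rewrite /bi_eval /= ltr_pwDl //; last first.
    by rewrite mulr_ge0 ?(bi_eval_ge0 hp) // ltW.
  case: r hr h => [|a r] //= /andP[_ hr] /ringZ_gt0 ha.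
  by rewrite ltr_pwDl // mulr_ge0 // uni_eval_ge0.
by rewrite /bi_eval /= ltr_wpDl ?uni_eval_ge0 // mulr_gt0.
Qed.

End BiSign.

(** * Sums over colors *)

Section ColorSums.
Variables (R : comPzRingType) (q : nat).

(** Colors are plain naturals and an assignment is a list, so that the same summand can be evaluated
    symbolically for every q at once. *)
Fixpoint color_sum (n : nat) (F : seq nat -> R) : R :=
  if n is m.+1 then \sum_(0 <= c < q) color_sum m (fun s => F (c :: s))
  else F [::].

(* [color_expand n k F] is the value of [color_sum n F] when [F] only
   distinguishes the colors below k: the q - k others are represented by the
   color k, which then becomes distinguished. *)
Fixpoint color_expand (n k : nat) (F : seq nat -> R) : R :=
  if n is m.+1 then
    \sum_(0 <= j < k) color_expand m k (fun s => F (j :: s))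
    + (q%:R - k%:R) * color_expand m k.+1 (fun s => F (k :: s))
  else F [::].

Lemma eq_color_sum n F F' : F =1 F' -> color_sum n F = color_sum n F'.
Proof.
elim: n F F' => [|n IH] F F' eqF /=; first exact: eqF.
by apply: eq_bigr => c _; apply: IH => s; apply: eqF.
Qed.

Lemma big_color_perm (r : nat -> nat) (F : nat -> R) :
  injective r -> (forall c, (c < q)%N -> (r c < q)%N) ->
  \sum_(0 <= c < q) F (r c) = \sum_(0 <= c < q) F c.
Proof.
move=> r_inj r_lt; rewrite -(big_map r xpredT); apply: perm_big.
have u : uniq (map r (index_iota 0 q)) by rewrite map_inj_uniq ?iota_uniq.
apply: uniq_perm; rewrite ?iota_uniq //.
apply: (uniq_min_size u _ _).2 => [c /mapP[d]|]; last by rewrite size_map.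
by rewrite !mem_index_iota => /r_lt rd ->.
Qed.

Lemma color_sum_perm (r : nat -> nat) n F :
  injective r -> (forall c, (c < q)%N -> (r c < q)%N) ->
  color_sum n (fun s => F (map r s)) = color_sum n F.
Proof.
move=> r_inj r_lt; elim: n F => [|n IH] F //=.
rewrite -[RHS](big_color_perm _ r_inj r_lt).
by apply: eq_bigr => c _; apply: (IH (fun s => F (r c :: s))).
Qed.

Definition color_swap (i j c : nat) : nat :=
  if c == i then j else if c == j then i else c.

Lemma color_swapK i j : involutive (color_swap i j).
Proof. by move=> c; rewrite /color_swap; do ![case: eqP => //=]; lia. Qed.

Lemma color_swap_id i j k c :
  (k <= i)%N -> (k <= j)%N -> (c < k)%N -> color_swap i j c = c.
Proof. by rewrite /color_swap; do ![case: eqP]; lia. Qed.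

(** Exchanging k with a first color c >= k fixes every color below k, so the q - k values of c from
    k on contribute equally. Once k has been used, only the colors above it remain interchangeable,
    which is the induction hypothesis at [k.+1]. *)
Lemma color_sumE n k F : (k <= q)%N ->
  (forall i j s, (k <= i)%N -> (k <= j)%N ->
     F (map (color_swap i j) s) = F s) ->
  color_sum n F = color_expand n k F.
Proof.
elim: n k F => [|n IH] k F kq F_inv //=.
rewrite (big_cat_nat (n := k)) //=; congr (_ + _).
  apply: eq_big_nat => j /andP[_ jk]; apply: IH => // a b s ka kb.
  by rewrite -{1}(color_swap_id ka kb jk) -map_cons F_inv.
rewrite -natrB // mulr_natl -sumr_const_nat.
apply: eq_big_nat => c /andP[kc cq].
(* Invariance turns the leading c into k at the cost of swapping the remaining colors; the swap then
   disappears, being a permutation of the summation range. *)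
rewrite (@eq_color_sum _ _ (fun s => F (k :: map (color_swap k c) s))).
  rewrite (@color_sum_perm (color_swap k c) n (fun s => F (k :: s))).
  - apply: IH => [|a b s ka kb]; first exact: leq_trans cq.
    by rewrite -{1}(color_swap_id ka kb (ltnSn k)) -map_cons F_inv // ltnW.
  - exact/inv_inj/color_swapK.
  by move=> d dq; rewrite /color_swap; do ![case: eqP]; lia.
move=> s; rewrite -(F_inv c k (c :: s)) //=; congr (F (_ :: _)).
  by rewrite /color_swap eqxx.
by apply: eq_map => d; rewrite /color_swap; do ![case: eqP]; lia.
Qed.

End ColorSums.

(** The symbolic counterpart of [color_expand]: the polynomial [qp] stands for the number of
    colors. *)
Fixpoint bi_expand (qp : bipoly) (n k : nat) (F : seq nat -> bipoly) : bipoly :=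
  if n is m.+1 then
    foldr (fun j acc => (bi_expand qp m k (fun s => F (j :: s)) + acc)%BP)
      ((qp - bi_const (Z.of_nat k))
         * bi_expand qp m k.+1 (fun s => F (k :: s)))%BP
      (iota 0 k)
  else F [::].

Lemma bi_expandE (R : comPzRingType) (x y : R) (q : nat) qp n k F :
  bi_eval x y qp = q%:R ->
  bi_eval x y (bi_expand qp n k F) =
  color_expand q n k (fun s => bi_eval x y (F s)).
Proof.
move=> qpE; elim: n k F => [|n IH] k F //=.
rewrite -(IH k.+1 (fun s => F (k :: s))) -(ringZ_nat _ k) -(bi_evalC x y) -qpE.
rewrite -bi_evalB -bi_evalM.
move: (_ * _)%BP => p; rewrite /index_iota subn0.
elim: (iota 0 k) => [|j l IHl]; first by rewrite big_nil add0r.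
by rewrite /= bi_evalD IHl IH big_cons addrA.
Qed.

Lemma color_expandD (R : comPzRingType) (q n k : nat) (F F' : seq nat -> R) :
  color_expand q n k (fun s => F s + F' s) =
  color_expand q n k F + color_expand q n k F'.
Proof.
elim: n k F F' => [|n IH] k F F' //=.
by rewrite (eq_bigr _ (fun j _ => IH _ _ _)) big_split IH mulrDr addrACA.
Qed.

Lemma color_expandZ (R : comPzRingType) (q n k : nat) (a : R)
    (F : seq nat -> R) :
  color_expand q n k (fun s => a * F s) = a * color_expand q n k F.
Proof.
elim: n k F => [|n IH] k F //=.
by rewrite (eq_bigr _ (fun j _ => IH _ _)) -mulr_sumr IH mulrDr mulrCA.
Qed.

Lemma eq_color_expand (R : comPzRingType) (q n k : nat)
    (F F' : seq nat -> R) :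
  F =1 F' -> color_expand q n k F = color_expand q n k F'.
Proof.
elim: n k F F' => [|n IH] k F F' eqF /=; first exact: eqF.
congr (_ + _ * _); last by apply: IH => s; apply: eqF.
by apply: eq_bigr => j _; apply: IH => s; apply: eqF.
Qed.

(** * Local views *)

(* The part of a colored cubic graph seen from a vertex v with neighbors
   u1, u2, u3: the adjacencies u1u2, u1u3, u2u3, and for each ui the list of
   the colors of its neighbors outside {v, u1, u2, u3}. *)
Definition view : Type := bool * bool * bool * (seq nat * seq nat * seq nat).

Definition center_mono (c u1 u2 u3 : nat) : nat :=
  (u1 == c) + (u2 == c) + (u3 == c).

(** Only edges meeting the closed neighborhood of v are counted: these are the ones whose status
    changes under resampling. *)
Definition view_mono (V : view) (c u1 u2 u3 : nat) : nat :=
  let: (a12, a13, a23, (l1, l2, l3)) := V in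
  center_mono c u1 u2 u3
  + (a12 && (u1 == u2)) + (a13 && (u1 == u3)) + (a23 && (u2 == u3))
  + count_mem u1 l1 + count_mem u2 l2 + count_mem u3 l3.

Definition center_const (u1 u2 u3 : nat) : nat := (u1 == u2) && (u1 == u3).

(** The number of [ui] whose neighborhood is monochromatic. As v belongs to each of these
    neighborhoods, the common color can only be c. *)
Definition nbr_const (V : view) (c u1 u2 u3 : nat) : nat :=
  let: (a12, a13, a23, (l1, l2, l3)) := V in
  [&& a12 ==> (u2 == c), a13 ==> (u3 == c) & all (pred1 c) l1]
  + [&& a12 ==> (u1 == c), a23 ==> (u3 == c) & all (pred1 c) l2]
  + [&& a13 ==> (u1 == c), a23 ==> (u2 == c) & all (pred1 c) l3].

Definition view_map (r : nat -> nat) (V : view) : view :=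
  let: (a, (l1, l2, l3)) := V in (a, (map r l1, map r l2, map r l3)).

Definition view_colors (V : view) : seq nat :=
  let: (_, (l1, l2, l3)) := V in l1 ++ l2 ++ l3.

(** A bound above every color of the view; for a canonical view it is the number of distinct
    colors. *)
Definition view_ncolors (V : view) : nat :=
  foldr (fun c m => maxn c.+1 m) 0%N (view_colors V).

Definition swap12 (V : view) : view :=
  let: (a12, a13, a23, (l1, l2, l3)) := V in (a12, a23, a13, (l2, l1, l3)).
Definition swap23 (V : view) : view :=
  let: (a12, a13, a23, (l1, l2, l3)) := V in (a13, a12, a23, (l1, l3, l2)).
Definition rev1 (V : view) : view :=
  let: (a, (l1, l2, l3)) := V in (a, (rev l1, l2, l3)).
Definition rev2 (V : view) : view :=
  let: (a, (l1, l2, l3)) := V in (a, (l1, rev l2, l3)).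
Definition rev3 (V : view) : view :=
  let: (a, (l1, l2, l3)) := V in (a, (l1, l2, rev l3)).

(** [view_orbit] applies or omits each entry in turn. The subwords of (12)(23)(12) give all six
    permutations of the [ui], and a reversal is the only nontrivial permutation of a list of at most
    two colors. *)
Definition view_symmetries : seq (view -> view) :=
  [:: swap12; swap23; swap12; rev1; rev2; rev3].

Definition view_orbit (V : view) : seq view :=
  foldl (fun s g => s ++ map g s) [:: V] view_symmetries.

Lemma view_orbitP (T : Type) (f : view -> T) :
  (forall i V, (i < size view_symmetries)%N ->
     f (nth id view_symmetries i V) = f V) ->
  forall V V', V' \in view_orbit V -> f V' = f V.
Proof.
rewrite /view_orbit => f_inv V.
have : forall W, W \in [:: V] -> f W = f V by move=> W; rewrite inE => /eqP->.
elim: view_symmetries [:: V] f_inv => [|g gs IH] s f_inv sP //= V'.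
apply: IH => [i W|W]; first exact: (f_inv i.+1).
by rewrite mem_cat => /orP[/sP //|/mapP[W' /sP <- ->]]; apply: (f_inv 0%N).
Qed.

Section ViewSum.
Variables (R : comPzRingType) (q : nat) (e D G B : R).

(** With e the exponential of the inverse temperature, this is the Boltzmann weight times e^9, which
    makes it polynomial in e, multiplied by the quantity whose conditional mean is studied. *)
Definition view_weight (V : view) (s : seq nat) : R :=
  if s is [:: c; u1; u2; u3] then
    e ^+ (9 - view_mono V c u1 u2 u3) *
      (D * (center_mono c u1 u2 u3)%:R
       + G * (3 * (center_const u1 u2 u3)%:R - (nbr_const V c u1 u2 u3)%:R)
       - B)
  else 0.

Definition view_sum (V : view) : R := color_sum q 4 (view_weight V).

Lemma view_weight_map (r : nat -> nat) V s : injective r ->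
  view_weight (view_map r V) (map r s) = view_weight V s.
Proof.
move=> r_inj; case: V => [[[a12 a13] a23] [[l1 l2] l3]].
case: s => [|c [|u1 [|u2 [|u3 [|? ?]]]]] //.
rewrite /view_weight /= /center_mono /center_const !count_map !all_map.
have h (d : nat) : preim r (pred1 (r d)) =1 pred1 d.
  by move=> d' /=; rewrite (inj_eq r_inj).
by rewrite !(inj_eq r_inj) !(eq_count (h _)) !(eq_all (h _)).
Qed.

Lemma view_sum_map (r : nat -> nat) V : injective r ->
  (forall c, (c < q)%N -> (r c < q)%N) -> view_sum (view_map r V) = view_sum V.
Proof.
move=> r_inj r_lt; rewrite /view_sum -(color_sum_perm _ _ r_inj r_lt).
by apply: eq_color_sum => s; rewrite view_weight_map.
Qed.

Lemma view_sum_swap12 V : view_sum (swap12 V) = view_sum V.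
Proof.
case: V => [[[a12 a13] a23] [[l1 l2] l3]]; rewrite /view_sum /=.
apply: eq_bigr => c _; rewrite exchange_big /=.
apply: eq_bigr => u1 _; apply: eq_bigr => u2 _; apply: eq_bigr => u3 _.
congr (e ^+ (9 - _) * (D * _%:R + G * (3 * _%:R - _%:R) - B)).
- by rewrite /center_mono [u2 == u1]eq_sym; lia.
- by rewrite /center_mono; lia.
- by rewrite /center_const; do ![case: eqP => //=]; lia.
- by rewrite [(a23 ==> (u2 == c)) && _]andbCA
    [in LHS](addnC (nat_of_bool _) (nat_of_bool _)).
Qed.

Lemma view_sum_swap23 V : view_sum (swap23 V) = view_sum V.
Proof.
case: V => [[[a12 a13] a23] [[l1 l2] l3]]; rewrite /view_sum /=.
apply: eq_bigr => c _; apply: eq_bigr => u1 _; rewrite exchange_big /=.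
apply: eq_bigr => u2 _; apply: eq_bigr => u3 _.
congr (e ^+ (9 - _) * (D * _%:R + G * (3 * _%:R - _%:R) - B)).
- by rewrite /center_mono [u3 == u2]eq_sym; lia.
- by rewrite /center_mono; lia.
- by rewrite /center_const andbC.
by rewrite [(a13 ==> (u3 == c)) && _]andbCA addnAC.
Qed.

Lemma eq_view_sum a l1 l2 l3 l1' l2' l3' :
  perm_eq l1 l1' -> perm_eq l2 l2' -> perm_eq l3 l3' ->
  view_sum (a, (l1, l2, l3)) = view_sum (a, (l1', l2', l3')).
Proof.
case: a => [[a12 a13] a23] p1 p2 p3; apply: eq_color_sum.
case=> [|c [|u1 [|u2 [|u3 [|? ?]]]]] //=.
rewrite !(perm_all _ p1) !(perm_all _ p2) !(perm_all _ p3).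
by rewrite !(permP p1) !(permP p2) !(permP p3).
Qed.

Lemma view_sum_symmetries i V :
  (i < size view_symmetries)%N ->
  view_sum (nth id view_symmetries i V) = view_sum V.
Proof.
move: i => [|[|[|[|[|[|//]]]]]] _ /=.
all: rewrite ?view_sum_swap12 ?view_sum_swap23 //.
all: case: V => [a [[l1 l2] l3]]; apply: eq_view_sum; by rewrite ?perm_rev.
Qed.

End ViewSum.

(** * Canonical names for the colors of a view *)

Definition add_new (acc : seq nat) (c : nat) : seq nat :=
  if c \in acc then acc else rcons acc c.
Definition news (acc l : seq nat) : seq nat := foldl add_new acc l.

Definition view_canon (V : view) : view :=
  view_map (index^~ (news [::] (view_colors V))) V.

(** Restricted growth strings, the usual codes of set partitions, with k letters already in use. *)
Fixpoint canon_lists (n k : nat) : seq (seq nat) :=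
  if n is m.+1 then
    map (cons k) (canon_lists m k.+1)
    ++ flatten [seq map (cons j) (canon_lists m k) | j <- iota 0 k]
  else [:: [::]].

Lemma news_ext acc l : exists t, news acc l = acc ++ t.
Proof.
elim: l acc => [|c l IH] acc; first by exists [::]; rewrite cats0.
rewrite /news /= -/(news _ _); have [t ->] := IH (add_new acc c).
rewrite /add_new; case: ifP => _; first by exists t.
by exists (c :: t); rewrite cat_rcons.
Qed.

Lemma news_uniq acc l : uniq acc -> uniq (news acc l).
Proof.
elim: l acc => [|c l IH] acc //= acc_u; apply: IH.
by rewrite /add_new; case: ifPn => // h; rewrite rcons_uniq h.
Qed.

Lemma mem_news acc l c : (c \in news acc l) = (c \in acc) || (c \in l).
Proof.
elim: l acc => [|d l IH] acc /=; first by rewrite orbF.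
rewrite IH inE orbA /add_new; congr (_ || _).
case: ifPn => h; last by rewrite mem_rcons inE orbC.
by case: eqP => [->|]; rewrite ?h ?orbF.
Qed.

(** Later colors are only appended to the accumulator, so the index of a color is settled when it
    first appears: either it was already there, or it gets the next free number. *)
Lemma map_index_news l acc : 
  map (index^~ (news acc l)) l \in canon_lists (size l) (size acc).
Proof.
elim: l acc => [|c l IH] acc //=; rewrite -/(news _ _).
have [t tE] := news_ext (add_new acc c) l; rewrite mem_cat.
have -> : index c (news (add_new acc c) l) = index c (add_new acc c).
  rewrite tE index_cat (_ : c \in _) // /add_new.
  by case: ifP => // _; rewrite mem_rcons mem_head.
have := IH (add_new acc c); set s := map _ _; rewrite /add_new.
case: ifPn => hc sP.
  apply/orP; right; apply/flattenP.
  exists (map (cons (index c acc)) (canon_lists (size l) (size acc))).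
    by apply/mapP; exists (index c acc); rewrite ?mem_iota ?index_mem.
  by rewrite mem_map // => ? ? [].
apply/orP; left; rewrite -cats1 index_cat (negbTE hc) /= eqxx addn0.
by rewrite size_rcons in sP; rewrite mem_map // => ? ? [].
Qed.

Section Rename.
Variables (q : nat) (V : view).
Hypothesis V_lt : all (fun c => c < q)%N (view_colors V).

Let S := news [::] (view_colors V).
(** Indices in S alone do not separate the unseen colors. Listing these after S, and fixing
    everything from q on, extends the canonical renaming to an injection r preserving the range of
    colors. *)
Let S' := S ++ [seq c <- iota 0 q | c \notin S].
Let r c := if (c < q)%N then index c S' else c.

Let S_lt c : c \in S -> (c < q)%N.
Proof. by rewrite mem_news => /= /(allP V_lt). Qed.

Let mem_S' c : (c \in S') = (c < q)%N.
Proof.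
rewrite mem_cat mem_filter mem_iota /= add0n.
by case: (boolP (c \in S)) => //= /S_lt ->.
Qed.

Let size_S' : size S' = q.
Proof.
rewrite -[RHS](size_iota 0); apply/perm_size/uniq_perm; rewrite ?iota_uniq //.
  rewrite cat_uniq news_uniq //= filter_uniq ?iota_uniq // andbT.
  by apply/hasPn => c; rewrite mem_filter => /andP[].
by move=> c; rewrite mem_iota -mem_S'.
Qed.

Let r_lt c : (c < q)%N -> (r c < q)%N.
Proof.
by move=> cq; rewrite /r cq -[X in (_ < X)%N]size_S' index_mem mem_S'.
Qed.

Let r_inj : injective r.
Proof.
move=> c d; rewrite /r; case: ifPn => cq; case: ifPn => dq //.
- have cS : c \in S' by rewrite mem_S'.
  have dS : d \in S' by rewrite mem_S'.
  exact: index_inj.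
- by move=> E; have := r_lt cq; rewrite /r cq E (negbTE dq).
- by move=> E; have := r_lt dq; rewrite /r dq -E (negbTE cq).
Qed.

Let canonE : view_canon V = view_map r V.
Proof.
have h c : c \in view_colors V -> index c S = r c.
  move=> cV; have cS : c \in S by rewrite mem_news.
  by rewrite /r (allP V_lt _ cV) index_cat cS.
rewrite /view_canon -/S; case: V h => [a [[l1 l2] l3]] /= h.
by congr (_, (_, _, _)); apply/eq_in_map => c cl; apply: h;
  rewrite !mem_cat cl ?orbT.
Qed.

Lemma view_canon_map : exists r : nat -> nat,
  [/\ injective r, forall c, (c < q)%N -> (r c < q)%N
    & view_canon V = view_map r V].
Proof. by exists r; split. Qed.

Lemma view_ncolors_canon : (view_ncolors (view_canon V) <= q)%N.
Proof.
have -> : view_ncolors (view_canon V) =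
    foldr (fun c m => maxn c.+1 m) 0%N (map r (view_colors V)).
  rewrite canonE /view_ncolors; case: (V) => [a [[l1 l2] l3]] /=.
  by rewrite !map_cat.
elim: (view_colors V) V_lt => //= c l IH /andP[cq /IH h].
by rewrite geq_max r_lt.
Qed.

End Rename.

(** Each [ui] has two neighbors besides v, and each adjacency among the [ui] uses one up; this fixes
    where the list of outer colors is cut. *)
Definition view_of (a : bool * bool * bool) (l : seq nat) : view :=
  let: (a12, a13, a23) := a in
  let n1 := (2 - a12 - a13)%N in let n2 := (2 - a12 - a23)%N in
  (a, (take n1 l, take n2 (drop n1 l), drop n2 (drop n1 l))).

(* Representatives of the views up to renaming of the colors and
   permutation of u1, u2, u3. *)
Definition view_reps : seq view :=
  map (view_of (false, false, false))
    [:: [:: 0;0;0;0;0;0]; [:: 0;0;0;0;0;1]; [:: 0;0;0;0;1;1]; [:: 0;0;0;0;1;2];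
        [:: 0;0;0;1;0;1]; [:: 0;0;0;1;0;2]; [:: 0;0;0;1;1;1]; [:: 0;0;0;1;1;2];
        [:: 0;0;0;1;2;2]; [:: 0;0;0;1;2;3]; [:: 0;0;1;1;2;2]; [:: 0;0;1;1;2;3];
        [:: 0;0;1;2;1;2]; [:: 0;0;1;2;1;3]; [:: 0;0;1;2;3;4]; [:: 0;1;0;1;0;1];
        [:: 0;1;0;1;0;2]; [:: 0;1;0;1;2;3]; [:: 0;1;0;2;0;3]; [:: 0;1;0;2;1;2];
        [:: 0;1;0;2;1;3]; [:: 0;1;0;2;3;4]; [:: 0;1;2;3;4;5]]%N
  ++ map (view_of (false, false, true)) (canon_lists 4 0)
  ++ map (view_of (true, false, true)) (canon_lists 2 0)
  ++ [:: view_of (true, true, true) [::]].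

Definition view_size (a : bool * bool * bool) : nat :=
  let: (a12, a13, a23) := a in (6 - 2 * (a12 + a13 + a23))%N.

Definition adjacencies : seq (bool * bool * bool) :=
  let bools := [:: false; true] in
  [seq (b, c) | b <- [seq (b1, b2) | b1 <- bools, b2 <- bools], c <- bools].

(** A finite check. The colors are renamed again after a symmetry, since reordering the lists
    changes the order of first appearance. *)
Lemma view_repsP :
  all (fun a => all (fun l => has (fun W => view_canon W \in view_reps)
                                  (view_orbit (view_of a l)))
                    (canon_lists (view_size a) 0)) adjacencies.
Proof. by vm_compute. Qed.

(** * View sums as polynomials *)

Definition bi_e : bipoly := [:: [:: 1%coqZ]; [:: 1%coqZ]].
Definition bi_e_powers : seq bipoly := [seq (bi_e ^ j)%BP | j <- iota 0 10].

Definition bi_leaf (f : view -> nat -> nat -> nat -> nat -> Z) (V : view)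
    (s : seq nat) : bipoly :=
  if s is [:: c; u1; u2; u3] then
    let z := f V c u1 u2 u3 in
    if Z.eqb z 0 then [::]
    else bi_scale z (nth [::] bi_e_powers (9 - view_mono V c u1 u2 u3))
  else [::].

Definition coef_one (_ : view) (_ _ _ _ : nat) : Z := 1%coqZ.
Definition coef_mono (_ : view) (c u1 u2 u3 : nat) : Z :=
  Z.of_nat (center_mono c u1 u2 u3).
Definition coef_const (V : view) (c u1 u2 u3 : nat) : Z :=
  (3 * Z.of_nat (center_const u1 u2 u3)
     - Z.of_nat (nbr_const V c u1 u2 u3))%coqZ.

(** The large polynomials D, G and B are kept out of the expansion: three sums with small
    coefficients are computed first and combined once. *)
Definition bi_view (qp D G B : bipoly) (V : view) : bipoly :=
  let sum f := bi_expand qp 4 (view_ncolors V) (bi_leaf f V) in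
  (D * sum coef_mono + G * sum coef_const - B * sum coef_one)%BP.

Section Eval.
Variables (R : comPzRingType) (x y : R) (q : nat) (qp : bipoly).
Hypothesis qpE : bi_eval x y qp = q%:R.

Lemma bi_e_powersE j : (j < 10)%N ->
  bi_eval x y (nth [::] bi_e_powers j) = (1 + x) ^+ j.
Proof.
move=> j10; rewrite (nth_map 0%N) ?size_iota // nth_iota // add0n.
rewrite bi_evalX; congr (_ ^+ _).
by rewrite /bi_eval /= !(mulr0, addr0) /ringZ /= mulr1.
Qed.

Lemma bi_leafE f V c u1 u2 u3 :
  bi_eval x y (bi_leaf f V [:: c; u1; u2; u3]) =
  ringZ R (f V c u1 u2 u3) * (1 + x) ^+ (9 - view_mono V c u1 u2 u3).
Proof.
rewrite /bi_leaf; case: Z.eqb_spec => [->|_]; first by rewrite mul0r.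
by rewrite bi_evalZ bi_e_powersE // ltnS leq_subr.
Qed.

(** Exchanging two colors that are at least [view_ncolors V] leaves the view unchanged, so
    [color_sumE] applies; the rest is linearity of the expansion. *)
Lemma bi_viewE D G B V : (view_ncolors V <= q)%N ->
  bi_eval x y (bi_view qp D G B V) =
  view_sum q (1 + x) (bi_eval x y D) (bi_eval x y G) (bi_eval x y B) V.
Proof.
move=> Vq; rewrite /bi_view bi_evalB bi_evalD !bi_evalM !(bi_expandE _ _ _ qpE).
rewrite /view_sum (color_sumE _ Vq); last first.
  move=> i j s ki kj.
  rewrite -[in RHS](view_weight_map _ _ _ _ V s (inv_inj (color_swapK i j))).
  congr (view_weight _ _ _ _ _ _).
  have: all (fun c => c < view_ncolors V)%N (view_colors V).
    rewrite /view_ncolors; elim: (view_colors V) => //= c l IH.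
    rewrite leq_max ltnSn; apply: sub_all IH => d dl.
    by rewrite leq_max dl orbT.
  have h l : all (fun c => c < view_ncolors V)%N l -> l = map (color_swap i j) l.
    move=> hl; rewrite -[LHS]map_id; apply/eq_in_map => c /(allP hl) ck.
    by rewrite (color_swap_id ki kj).
  case: V {Vq} ki kj h => [a [[l1 l2] l3]] ki kj h /=; rewrite !all_cat.
  by case/and3P=> /h <- /h <- /h <-.
rewrite -mulNr -!color_expandZ -!color_expandD; apply: eq_color_expand.
case=> [|c [|u1 [|u2 [|u3 [|? ?]]]]]; rewrite ?bi_leafE /bi_eval /=;
  rewrite ?(mulr0, addr0) //.
rewrite /coef_one /coef_mono /coef_const ringZ_nat.
have -> : ringZ R (3 * Z.of_nat (center_const u1 u2 u3)
    - Z.of_nat (nbr_const V c u1 u2 u3))%coqZ =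
    3 * (center_const u1 u2 u3)%:R - (nbr_const V c u1 u2 u3)%:R.
  by rewrite -!ringZ_nat -(ringZM R) /ringZ -rmorphB; congr (_%:~R); lia.
rewrite (_ : ringZ R 1%coqZ = 1) //.
ring.
Qed.

End Eval.

(** * From the representatives to all views *)

Definition sign_ok (b : bool) (R : numDomainType) (s : R) : Prop :=
  if b then s = 0 else 0 < s.

Section LocalBound.
Variables (PD PG PB : bipoly -> bipoly) (tight : view -> bool).
Hypothesis tight_map : forall r V, injective r ->
  tight (view_map r V) = tight V.
Hypothesis tight_symmetries : forall i V,
  (i < size view_symmetries)%N -> tight (nth id view_symmetries i V) = tight V.

Definition bi_view_ok (qp : bipoly) (V : view) : bool :=
  let p := bi_view qp (PD qp) (PG qp) (PB qp) V in
  if tight V then bi_zero p else bi_pos p.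

(** The case q = 2 is checked on its own, and only for views that two colors can realize; the other
    test covers all larger q with room for the colors seen. *)
Definition view_ok (V : view) : bool :=
  ((view_ncolors V <= 2)%N ==> bi_view_ok (bi_const 2) V) &&
  bi_view_ok [:: [:: Z.of_nat (maxn 3 (view_ncolors V)); 1%coqZ]] V.

Variables (R : realDomainType) (q : nat) (e D G B : R).
Hypotheses (q_ge2 : (2 <= q)%N) (e_gt1 : 1 < e).
Hypothesis coefE : forall y qp, bi_eval (e - 1) y qp = q%:R ->
  [/\ bi_eval (e - 1) y (PD qp) = D, bi_eval (e - 1) y (PG qp) = G
    & bi_eval (e - 1) y (PB qp) = B].

Lemma view_okP V : view_ok V -> (view_ncolors V <= q)%N ->
  sign_ok (tight V) (view_sum q e D G B V).
Proof.
have x_gt0 : 0 < e - 1 by rewrite subr_gt0.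
have H qp y : 0 <= y -> bi_eval (e - 1) y qp = q%:R -> bi_view_ok qp V ->
    (view_ncolors V <= q)%N -> sign_ok (tight V) (view_sum q e D G B V).
  move=> y_ge0 qpE ok Vq; have [DE GE BE] := coefE qpE.
  have := bi_viewE qpE (PD qp) (PG qp) (PB qp) Vq.
  rewrite DE GE BE (addrC 1) subrK => <-; move: ok; rewrite /bi_view_ok.
  by case: (tight V) => /=; [apply: bi_eval_zero | apply: bi_eval_gt0].
case/andP=> ok2 ok3 Vq; case: (ltnP 2 q) => hq.
  have kq : (maxn 3 (view_ncolors V) <= q)%N by rewrite geq_max hq.
  apply: H ok3 Vq; first exact: (ler0n _ (q - maxn 3 (view_ncolors V))).
  rewrite /bi_eval /= !mulr0 !addr0 ringZ_nat /ringZ /= mulr1.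
  by rewrite -natrD subnKC.
have q2 : q = 2%N by apply/eqP; rewrite eqn_leq hq.
apply: (H (bi_const 2) 0) (Vq); first exact: lexx.
  by rewrite bi_evalC q2.
by move/implyP: ok2; apply; rewrite -q2.
Qed.

Hypothesis reps_ok : all view_ok view_reps.

(** Renaming the colors, applying a symmetry and renaming again leads to a representative; neither
    the sum nor tightness changes on the way. *)
Lemma view_sum_sign a l : size l = view_size a ->
  all (fun c => c < q)%N l ->
  sign_ok (tight (view_of a l)) (view_sum q e D G B (view_of a l)).
Proof.
have colors_of l' : view_colors (view_of a l') = l'.
  by rewrite /view_of; case: (a) => [[a12 a13] a23] /=; rewrite !cat_take_drop.
pose lt_q V := all (fun c => c < q)%N (view_colors V).
have canon_inv V : lt_q V ->
    [/\ tight (view_canon V) = tight V,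
        view_sum q e D G B (view_canon V) = view_sum q e D G B V
      & lt_q (view_canon V)].
  move=> /[dup] V_lt /view_canon_map[r [r_inj r_lt ->]].
  rewrite tight_map // view_sum_map //; split=> //.
  rewrite /lt_q; have -> : view_colors (view_map r V) = map r (view_colors V).
    by case: (V) => [b [[l1 l2] l3]] /=; rewrite !map_cat.
  by rewrite all_map; apply: sub_all V_lt => c /r_lt.
move=> l_size l_lt; pose l' := map (index^~ (news [::] l)) l.
have canonE : view_canon (view_of a l) = view_of a l'.
  rewrite /view_canon colors_of /view_of; case: (a) => [[a12 a13] a23] /=.
  by rewrite !map_take !map_drop.
have V_lt : lt_q (view_of a l) by rewrite /lt_q colors_of.
have [<- <-] := canon_inv _ V_lt; rewrite canonE => V'_lt.
have aP : a \in adjacencies by case: (a) => [[[] []] []].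
have l'P : l' \in canon_lists (view_size a) 0.
  by rewrite -l_size; apply: map_index_news.
have /hasP[W /view_orbitP W_orb W_rep] := allP (allP view_repsP a aP) l' l'P.
rewrite -(W_orb _ tight) // -(W_orb _ (view_sum q e D G B)); last first.
  by move=> i V' i_lt; apply: view_sum_symmetries.
(* Symmetries only reorder the colors, so W still uses colors below q and its second renaming is
   again a permutation of them. *)
have W_lt : lt_q W.
  rewrite (W_orb _ lt_q) // => i [b [[l1 l2] l3]].
  move: i b => [|[|[|[|[|[|//]]]]]] [[b12 b13] b23] _;
    rewrite /lt_q /= !all_cat ?all_rev; do !bool_congr.
have [<- <- _] := canon_inv _ W_lt; apply: view_okP.
  exact: (allP reps_ok).
exact: view_ncolors_canon.
Qed.

End LocalBound.

(* K4_Z is e^6/q times the partition function of K_4 and K4_mono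
   is e^6/q times the sum of the weighted numbers of monochromatic edges at one
   vertex. *)
Section K4Constants.
Variables (R : comPzRingType) (q e : R).
Definition K4_Z : R :=
  1 + 4 * (q - 1) * e ^+ 3 + 3 * (q - 1) * e ^+ 4
  + 6 * ((q - 1) * (q - 2)) * e ^+ 5
  + (q - 1) * (q - 2) * (q - 3) * e ^+ 6.
Definition K4_mono : R :=
  3 + 6 * (q - 1) * e ^+ 3 + 3 * (q - 1) * e ^+ 4
  + 3 * ((q - 1) * (q - 2)) * e ^+ 5.
End K4Constants.

(* star_p is, up to a power of e, the sum over the color of a vertex of the
   weights of its edges when its three neighbors have color pattern p; aa_Z and
   ab_Z are e^9 and e^6 times the local partition functions of the two views of
   K_{3,3}. Requiring equal conditional means for both views determines
   K33_dual; everything is scaled by the common denominator. *)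
Section K33Constants.
Variables (R : comPzRingType) (q e : R).
Definition star_3 : R := 1 + (q - 1) * e ^+ 3.
Definition star_21 : R := 1 + e + (q - 2) * e ^+ 2.
Definition star_111 : R := 3 + (q - 3) * e.
Definition aa_Z : R := star_3 ^+ 3 + (q - 1) * e ^+ 3 * star_21 ^+ 3.
Definition aa_mono : R :=
  3 * star_3 ^+ 2 + 3 * (q - 1) * e ^+ 4 * star_21 ^+ 2.
Definition ab_Z : R := 2 * star_21 ^+ 3 + (q - 2) * e ^+ 3 * star_111 ^+ 3.
Definition ab_mono : R :=
  6 * star_21 ^+ 2 + 3 * (q - 2) * e ^+ 3 * star_111 ^+ 2.
Definition K33_scale : R := 3 * star_3 * (2 + (q - 2) * e ^+ 3).
Definition K33_Z : R := (aa_Z + (q - 1) * e ^+ 3 * ab_Z) * K33_scale.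
Definition K33_mono : R := (aa_mono + (q - 1) * e ^+ 3 * ab_mono) * K33_scale.
Definition K33_dual : R := aa_mono * ab_Z - ab_mono * aa_Z.
End K33Constants.

Section BiConstants.
Local Open Scope bipoly_scope.
Local Notation C := bi_const.
Local Notation e := bi_e.
Variable q : bipoly.
Definition bi_K4_Z : bipoly :=
  C 1 + C 4 * (q - C 1) * e ^ 3 + C 3 * (q - C 1) * e ^ 4
  + C 6 * ((q - C 1) * (q - C 2)) * e ^ 5
  + (q - C 1) * (q - C 2) * (q - C 3) * e ^ 6.
Definition bi_K4_mono : bipoly :=
  C 3 + C 6 * (q - C 1) * e ^ 3 + C 3 * (q - C 1) * e ^ 4
  + C 3 * ((q - C 1) * (q - C 2)) * e ^ 5.
Definition bi_star_3 := C 1 + (q - C 1) * e ^ 3.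
Definition bi_star_21 := C 1 + e + (q - C 2) * e ^ 2.
Definition bi_star_111 := C 3 + (q - C 3) * e.
Definition bi_aa_Z :=
  bi_star_3 ^ 3 + (q - C 1) * e ^ 3 * bi_star_21 ^ 3.
Definition bi_aa_mono :=
  C 3 * bi_star_3 ^ 2 + C 3 * (q - C 1) * e ^ 4 * bi_star_21 ^ 2.
Definition bi_ab_Z :=
  C 2 * bi_star_21 ^ 3 + (q - C 2) * e ^ 3 * bi_star_111 ^ 3.
Definition bi_ab_mono :=
  C 6 * bi_star_21 ^ 2 + C 3 * (q - C 2) * e ^ 3 * bi_star_111 ^ 2.
Definition bi_K33_scale := C 3 * bi_star_3 * (C 2 + (q - C 2) * e ^ 3).
Definition bi_K33_Z := (bi_aa_Z + (q - C 1) * e ^ 3 * bi_ab_Z) * bi_K33_scale.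
Definition bi_K33_mono :=
  (bi_aa_mono + (q - C 1) * e ^ 3 * bi_ab_mono) * bi_K33_scale.
Definition bi_K33_dual := bi_aa_mono * bi_ab_Z - bi_ab_mono * bi_aa_Z.
End BiConstants.

Section BiConstantsEval.
Variables (R : comPzRingType) (e y : R) (qp : bipoly).
Local Notation ev := (bi_eval (e - 1) y).

Let ev_e : ev bi_e = e.
Proof.
rewrite /bi_eval /= !(mulr0, addr0) /ringZ /= mulr1.
by rewrite addrC subrK.
Qed.

Let evC n : ev (bi_const (Z.of_nat n)) = n%:R.
Proof. by rewrite bi_evalC ringZ_nat. Qed.

Let evE := (bi_evalB, bi_evalD, bi_evalM, bi_evalX, ev_e,
  evC 1, evC 2, evC 3, evC 4, evC 6).

Lemma bi_K4_ZE : ev (bi_K4_Z qp) = K4_Z (ev qp) e.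
Proof. by rewrite !evE. Qed.

Lemma bi_K4_monoE : ev (bi_K4_mono qp) = K4_mono (ev qp) e.
Proof. by rewrite !evE. Qed.

Lemma bi_K33_ZE : ev (bi_K33_Z qp) = K33_Z (ev qp) e.
Proof. by rewrite !evE. Qed.

Lemma bi_K33_monoE : ev (bi_K33_mono qp) = K33_mono (ev qp) e.
Proof. by rewrite !evE. Qed.

Lemma bi_K33_dualE : ev (bi_K33_dual qp) = K33_dual (ev qp) e.
Proof. by rewrite !evE. Qed.

End BiConstantsEval.

(** * Tight views and the finite verification *)

Definition K4_view (V : view) : bool :=
  let: (a12, a13, a23, _) := V in [&& a12, a13 & a23].

(** The three neighbors of a vertex of K_{3,3} share their other two neighbors, hence see the same
    pair of colors, in whatever order it is listed. *)
Definition K33_view (V : view) : bool :=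
  let: (a12, a13, a23, (l1, l2, l3)) := V in
  [&& ~~ a12, ~~ a13, ~~ a23, perm_eq l1 l2 & perm_eq l2 l3].

Lemma K4_view_map r V : K4_view (view_map r V) = K4_view V.
Proof. by case: V => [[[? ?] ?] [[? ?] ?]]. Qed.

Lemma K33_view_map r V : injective r -> K33_view (view_map r V) = K33_view V.
Proof.
move=> r_inj; case: V => [[[? ?] ?] [[l1 l2] l3]] /=.
have h l l' : perm_eq (map r l) (map r l') = perm_eq l l'.
  by apply/idP/idP; [apply: perm_map_inj | apply: perm_map].
by rewrite !h.
Qed.

Lemma K4_view_symmetries i V : (i < size view_symmetries)%N ->
  K4_view (nth id view_symmetries i V) = K4_view V.
Proof.
move: i => [|[|[|[|[|[|//]]]]]] _; case: V => [[[a b] c] [[? ?] ?]] //=;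
  by case: a b c => [] [] [].
Qed.

Lemma K33_view_symmetries i V : (i < size view_symmetries)%N ->
  K33_view (nth id view_symmetries i V) = K33_view V.
Proof.
have tr (l1 l2 l3 : seq nat) : perm_eq l1 l2 && perm_eq l2 l3 =
    perm_eq l1 l2 && perm_eq l1 l3.
  by case: (boolP (perm_eq l1 l2)) => //= /permPl ->.
have revl (l l' : seq nat) : perm_eq (rev l) l' = perm_eq l l'.
  exact: perm_rev.
have revr (l l' : seq nat) : perm_eq l (rev l') = perm_eq l l'.
  by rewrite perm_sym revl perm_sym.
move: i => [|[|[|[|[|[|//]]]]]] _; case: V => [[[a b] c] [[l1 l2] l3]] //=;
  case: a b c => [] [] [] //=; rewrite ?revl ?revr ?tr //.
1,3: rewrite (perm_sym l2 l1).
1,2: by case: (boolP (perm_eq l1 l2)) => //= /permPl ->.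
by rewrite andbC.
Qed.

(** Negating D and B turns the upper bound into a lower bound of the same form as for K_{3,3}. The
    empty list is the zero polynomial, so there is no indicator term. *)
Lemma K4_reps_ok :
  all (view_ok (fun qp => [::] - bi_K4_Z qp)%BP (fun=> [::])
               (fun qp => [::] - bi_K4_mono qp)%BP K4_view) view_reps.
Proof. by vm_compute. Qed.

Lemma K33_reps_ok :
  all (view_ok bi_K33_Z bi_K33_dual bi_K33_mono K33_view) view_reps.
Proof. by vm_compute. Qed.

(** Positivity of the coefficient of the energy, which is cancelled from the bound at the end. *)
Lemma bi_K33_Z_pos :
  bi_pos (bi_K33_Z (bi_const 2)) && bi_pos (bi_K33_Z [:: [:: 3; 1]%coqZ]).
Proof. by vm_compute. Qed.

Lemma bi_K4_Z_pos :
  bi_pos (bi_K4_Z (bi_const 2)) && bi_pos (bi_K4_Z [:: [:: 3; 1]%coqZ]).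
Proof. by vm_compute. Qed.

Definition view_wf (V : view) : bool :=
  let: (a12, a13, a23, (l1, l2, l3)) := V in
  [&& size l1 == 2 - a12 - a13, size l2 == 2 - a12 - a23
    & size l3 == 2 - a13 - a23]%N.

Lemma view_wf_of V : view_wf V ->
  exists2 a, V = view_of a (view_colors V) & size (view_colors V) = view_size a.
Proof.
case: V => [[[a12 a13] a23] [[l1 l2] l3]] /= /and3P[/eqP s1 /eqP s2 /eqP s3].
exists (a12, a13, a23); last first.
  by rewrite !size_cat s1 s2 s3 /=; case: (a12) (a13) (a23) => [] [] [].
rewrite /view_of -s1 -s2 take_size_cat // drop_size_cat //.
by rewrite take_size_cat // drop_size_cat.
Qed.

Section LocalSigns.
Variables (R : realDomainType) (q : nat) (e : R).
Hypotheses (q_ge2 : (2 <= q)%N) (e_gt1 : 1 < e).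

Lemma K33_view_sum_sign V :
  view_wf V -> all (fun c => c < q)%N (view_colors V) ->
  sign_ok (K33_view V)
    (view_sum q e (K33_Z q%:R e) (K33_dual q%:R e) (K33_mono q%:R e) V).
Proof.
move=> /view_wf_of[a Va aP] lq; rewrite Va.
apply: (@view_sum_sign bi_K33_Z bi_K33_dual bi_K33_mono K33_view
  K33_view_map K33_view_symmetries R q e _ _ _ q_ge2 e_gt1 _ K33_reps_ok) aP lq.
by move=> y qp qpE; rewrite bi_K33_ZE bi_K33_dualE bi_K33_monoE qpE.
Qed.

Lemma K4_view_sum_sign V :
  view_wf V -> all (fun c => c < q)%N (view_colors V) ->
  sign_ok (K4_view V)
    (view_sum q e (- K4_Z q%:R e) 0 (- K4_mono q%:R e) V).
Proof.
move=> /view_wf_of[a Va aP] lq; rewrite Va.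
have tight_map r W : injective r -> K4_view (view_map r W) = K4_view W.
  by move=> _; apply: K4_view_map.
apply: (@view_sum_sign (fun qp => [::] - bi_K4_Z qp)%BP (fun=> [::])
  (fun qp => [::] - bi_K4_mono qp)%BP K4_view
  tight_map K4_view_symmetries R q e _ _ _ q_ge2 e_gt1 _ K4_reps_ok) aP lq.
move=> y qp qpE; rewrite !bi_evalB bi_K4_ZE bi_K4_monoE qpE.
  by rewrite /bi_eval /= !sub0r.
Qed.

Let x_gt0 : 0 < e - 1. Proof. by rewrite subr_gt0. Qed.

Lemma bi_eval_q_gt0 (p : bipoly -> bipoly) (f : R -> R) :
  bi_pos (p (bi_const 2)) && bi_pos (p [:: [:: 3; 1]%coqZ]) ->
  (forall y qp, bi_eval (e - 1) y (p qp) = f (bi_eval (e - 1) y qp)) ->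
  0 < f q%:R.
Proof.
case/andP=> p2 p3 pE; case: (ltnP 2 q) => hq.
  have := bi_eval_gt0 x_gt0 (ler0n _ (q - 3)) p3.
  rewrite pE {1}/bi_eval /= !mulr0 !addr0 /ringZ /= mulr1.
  by rewrite -(natrD _ 3) subnKC.
have := bi_eval_gt0 x_gt0 (lexx 0) p2; rewrite pE bi_evalC.
by have -> : q = 2%N by apply/eqP; rewrite eqn_leq hq.
Qed.

Lemma K33_Z_gt0 : 0 < K33_Z q%:R e.
Proof.
apply: (@bi_eval_q_gt0 bi_K33_Z (fun r => K33_Z r e) bi_K33_Z_pos) => y qp.
exact: bi_K33_ZE.
Qed.

Lemma K4_Z_gt0 : 0 < K4_Z q%:R e.
Proof.
apply: (@bi_eval_q_gt0 bi_K4_Z (fun r => K4_Z r e) bi_K4_Z_pos) => y qp.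
exact: bi_K4_ZE.
Qed.

End LocalSigns.

(** * Resampling a closed neighborhood *)

Definition deg_mono (G : sgraph) (q : nat) (s : {ffun G -> 'I_q}) (x : G) : nat :=
  \sum_(y | adj x y) (s x == s y).

Definition const_nbhd (G : sgraph) (q : nat) (s : {ffun G -> 'I_q}) (x : G) :=
  [forall y, forall z, adj x y && adj x z ==> (s y == s z)].

(** The handshake count: the ordered monochromatic adjacent pairs are grouped by their underlying
    edge, and each edge comes from exactly two of them. *)
Lemma sum_deg_mono (G : sgraph) (q : nat) (s : {ffun G -> 'I_q}) :
  (\sum_x deg_mono s x = (mono_edges s).*2)%N.
Proof.
pose P := [set p : G * G | adj p.1 p.2 && (s p.1 == s p.2)].
pose f (p : G * G) := [set p.1; p.2].
have -> : (\sum_x deg_mono s x = \sum_(p in P) 1)%N.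
  rewrite /deg_mono pair_big_dep /= big_mkcond [RHS]big_mkcond /=.
  by apply: eq_bigr => p _; rewrite inE; case: adj; case: eqP.
rewrite (partition_big_imset f) /=.
rewrite /mono_edges.
have -> : [set E in edges G | [forall x in E, forall y in E, s x == s y]]
    = f @: P.
  apply/setP => E; rewrite inE; apply/andP/imsetP => [[/imsetP[p]]|[p]].
    rewrite inE => padj -> /forall_inP h; exists p => //; rewrite inE padj /=.
    by apply: (forall_inP (h p.1 _)); rewrite !inE eqxx ?orbT.
  rewrite inE => /andP[padj /eqP ps] ->; split.
    by apply/imsetP; exists p; rewrite ?inE.
  by apply/forall_inP => x /set2P[] ->; apply/forall_inP => y /set2P[] ->;
    rewrite ?ps.
rewrite -muln2 -sum_nat_const; apply: eq_bigr => E /imsetP[[x y]].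
rewrite inE /= => /andP[xy sxy] ->.
have xNy : x != y by apply: contraTneq xy => ->; rewrite adj_irrefl.
rewrite sum1_card -[RHS](_ : #|[set (x, y); (y, x)]| = 2); last first.
  by rewrite cards2 xpair_eqE (negbTE xNy).
apply: eq_card => -[a b]; rewrite unfold_in !inE /= !xpair_eqE.
apply/andP/orP => [[/andP[ab _] /eqP/setP ab_xy]|].
  have aNb : a != b by apply: contraTneq ab => ->; rewrite adj_irrefl.
  have := ab_xy a; rewrite !inE /= eqxx /= => /esym/orP[] /eqP ha; subst a.
    have := ab_xy b; rewrite !inE /= eqxx orbT eq_sym (negbTE aNb) /=.
    by move=> /esym ->; left; rewrite eqxx.
  have := ab_xy b; rewrite !inE /= eqxx orbT [b == y]eq_sym (negbTE aNb) orbF.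
  by move=> /esym ->; right; rewrite eqxx.
case=> /andP[/eqP-> /eqP->]; split; rewrite ?eqxx //.
- by rewrite xy.
- by rewrite adj_sym xy eq_sym.
by rewrite /f finset.setUC.
Qed.

(** Each y is met once from each of its three neighbors. This is what cancels the indicator terms in
    the sum over all vertices. *)
Lemma cubic_double_count (G : sgraph) (V : zmodType) (f : G -> V) : cubic G ->
  \sum_x \sum_(y | adj x y) f y = (\sum_x f x) *+ 3.
Proof.
move=> G3; rewrite (exchange_big_dep predT) //= -sumrMnl.
apply: eq_bigr => y _; rewrite -(G3 y) sumr_const; congr (_ *+ _).
by apply: eq_card => x; rewrite !inE adj_sym.
Qed.

Section Resampling.
Variables (T : finType) (q : nat) (R : comPzRingType).

Definition recolor (s : {ffun T -> 'I_q}) (x : T) (c : 'I_q) : {ffun T -> 'I_q} :=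
  [ffun y => if y == x then c else s y].

(** Exchanging the color at x with the new color is an involution on pairs of a coloring and a
    color; after it the summand ignores the second component. *)
Lemma sum_recolor (f : {ffun T -> 'I_q} -> R) (x : T) :
  \sum_s \sum_c f (recolor s x c) = q%:R * \sum_s f s.
Proof.
rewrite pair_big /=.
pose h (p : {ffun T -> 'I_q} * 'I_q) := (recolor p.1 x p.2, p.1 x).
have hK : involutive h.
  case=> s c; rewrite /h /=; congr (_, _); last by rewrite ffunE eqxx.
  by apply/ffunP => y; rewrite !ffunE; case: eqP => [->|].
rewrite (reindex_inj (inv_inj hK)) /=.
under eq_bigr => p _.
  have -> : recolor (recolor p.1 x p.2) x (p.1 x) = p.1.
    by have /(congr1 fst) := hK p.
  over.
rewrite -(pair_big predT predT (fun s _ => f s)) /= mulr_sumr.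
by apply: eq_bigr => s _; rewrite sumr_const card_ord mulr_natl.
Qed.

End Resampling.

Section StarView.
Variables (G : sgraph) (q : nat) (v u1 u2 u3 : G).
Let C := [:: v; u1; u2; u3].

Definition outer (u : G) : seq G :=
  [seq y <- enum G | adj u y && (y \notin C)].

Definition outer_colors (s : {ffun G -> 'I_q}) (u : G) : seq nat :=
  [seq nat_of_ord (s y) | y <- outer u].

Definition star_view (s : {ffun G -> 'I_q}) : view :=
  (adj u1 u2, adj u1 u3, adj u2 u3,
   (outer_colors s u1, outer_colors s u2, outer_colors s u3)).

Definition recolor_star (s : {ffun G -> 'I_q}) (c c1 c2 c3 : 'I_q) :=
  recolor (recolor (recolor (recolor s v c) u1 c1) u2 c2) u3 c3.

Lemma sum_outer (u : G) (p : pred G) :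
  (\sum_(y | y \notin C) (adj u y && p y) = count p (outer u))%N.
Proof.
rewrite -sum1_count /outer big_filter_cond big_enum_cond /=.
rewrite big_mkcond [RHS]big_mkcond /=.
apply: eq_bigr => y _.
by case: (y \in C); case: adj; case: (p y).
Qed.

Lemma star_view_lt s : all (fun c => c < q)%N (view_colors (star_view s)).
Proof.
by rewrite /= !all_cat; apply/and3P; split; apply/allP => c /mapP[y _ ->].
Qed.

Hypotheses (C_uniq : uniq C) (Nv : forall y, adj v y = (y \in [:: u1; u2; u3])).

Lemma sum_star (F : G -> nat) :
  (\sum_x F x = F v + F u1 + F u2 + F u3 + \sum_(x | x \notin C) F x)%N.
Proof.
rewrite (bigID (mem C)) /=; congr (_ + _)%N.
by rewrite -big_uniq //= !big_cons big_nil addn0 !addnA.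
Qed.

Let C_neq : [&& v != u1, v != u2, v != u3, u1 != u2, u1 != u3 & u2 != u3].
Proof. by move: C_uniq; rewrite /= !inE !negb_or -!andbA andbT. Qed.

Lemma recolor_starE s c c1 c2 c3 (s' := recolor_star s c c1 c2 c3) :
  [/\ s' v = c, s' u1 = c1, s' u2 = c2, s' u3 = c3
    & forall y, y \notin C -> s' y = s y].
Proof.
have /and5P[n1 n2 n3 n4 /andP[n5 n6]] := C_neq.
split=> [||||y]; rewrite /s' !ffunE ?eqxx ?(negbTE n1) ?(negbTE n2)
  ?(negbTE n3) ?(negbTE n4) ?(negbTE n5) ?(negbTE n6) //.
by rewrite !inE !negb_or => /and4P[/negbTE-> /negbTE-> /negbTE-> /negbTE->].
Qed.

Let adj_v : [/\ adj v v = false, adj v u1 = true, adj v u2 = true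
  & adj v u3 = true].
Proof. by rewrite adj_irrefl !Nv !inE !eqxx ?orbT. Qed.

Let adj_v' : [/\ adj u1 v = true, adj u2 v = true & adj u3 v = true].
Proof. by have [_ h1 h2 h3] := adj_v; split; rewrite adj_sym. Qed.

Hypothesis G3 : cubic G.

Let deg3 (u : G) : (\sum_y (adj u y : nat) = 3)%N.
Proof.
rewrite -(G3 u) -sum1_card big_mkcond [RHS]big_mkcond /=.
by apply: eq_bigr => y _; rewrite inE; case: adj.
Qed.

Lemma star_view_wf s : view_wf (star_view s).
Proof.
have [e1 e2 e3] := adj_v'.
have h u : (adj u v + adj u u1 + adj u u2 + adj u u3 + size (outer u) = 3)%N.
  rewrite -[RHS](deg3 u) sum_star; congr (_ + _)%N.
  rewrite -count_predT -sum_outer; apply: eq_bigr => y _; by rewrite andbT.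
rewrite /= !size_map; have := h u1; have := h u2; have := h u3.
rewrite !adj_irrefl e1 e2 e3 (adj_sym u2 u1) (adj_sym u3 u1) (adj_sym u3 u2).
move: (adj u1 u2) (adj u1 u3) (adj u2 u3) (size _) (size _) (size _).
by clear; case=> [] [] [] n1 n2 n3 /=; lia.
Qed.

(** Makes the truncated subtraction in [view_weight] exact. Without adjacencies among the [ui] there
    are 3 + 6 edges, and each adjacency adds one but removes two outer ones. *)
Lemma view_mono_le9 s c c1 c2 c3 : (view_mono (star_view s) c c1 c2 c3 <= 9)%N.
Proof.
have := star_view_wf s; rewrite /= => /and3P[/eqP h1 /eqP h2 /eqP h3].
have h (l : seq nat) d : (count_mem d l <= size l)%N by apply: count_size.
have ab (a b : bool) : (a && b <= a)%N by case: a b => [] [].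
move: (h (outer_colors s u1) c1) (h (outer_colors s u2) c2)
  (h (outer_colors s u3) c3) (ab (adj u1 u2) (c1 == c2))
  (ab (adj u1 u3) (c1 == c3)) (ab (adj u2 u3) (c2 == c3))
  (leq_b1 (c1 == c)) (leq_b1 (c2 == c)) (leq_b1 (c3 == c))
  (leq_b1 (adj u1 u2)) (leq_b1 (adj u1 u3)) (leq_b1 (adj u2 u3)).
rewrite h1 h2 h3 /center_mono.
do ![move: (nat_of_bool _) => ?]; do ![move: (count_mem _ _) => ?].
by clear; lia.
Qed.

Let outer_v : outer v = [::].
Proof.
apply/eqP; rewrite -(negbK (_ == _)) -has_filter; apply/hasPn => y _.
rewrite Nv; case: (boolP (y \in [:: u1; u2; u3])) => //= h.
by rewrite negbK in_cons h orbT.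
Qed.

Section Recolored.
Variables (s : {ffun G -> 'I_q}) (c c1 c2 c3 : 'I_q).
Let s' := recolor_star s c c1 c2 c3.

Let mono_outer u (d : 'I_q) :
  (\sum_(y | y \notin C) (adj u y && (d == s' y)) =
   count_mem (d : nat) (outer_colors s u))%N.
Proof.
have [_ _ _ _ out] := recolor_starE s c c1 c2 c3.
rewrite count_map -sum_outer; apply: eq_bigr => y /out; rewrite /s' => ->.
by rewrite eq_sym -val_eqE.
Qed.

Definition mono_outside : nat :=
  (\sum_(x | x \notin C) \sum_(y | y \notin C) (adj x y && (s x == s y)))./2.

Lemma deg_monoE (t : {ffun G -> 'I_q}) x :
  deg_mono t x = (\sum_y (adj x y && (t x == t y)))%N.
Proof.
by rewrite /deg_mono big_mkcond /=; apply: eq_bigr => y _; case: adj.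
Qed.

Lemma deg_mono_center : deg_mono s' v = center_mono c c1 c2 c3.
Proof.
have [sv s1 s2 s3 _] := recolor_starE s c c1 c2 c3.
have [a0 a1 a2 a3] := adj_v.
rewrite deg_monoE sum_star mono_outer /outer_colors outer_v /=.
rewrite a0 a1 a2 a3 /s' sv s1 s2 s3 /= add0n addn0 /center_mono.
by rewrite !(eq_sym c) -!val_eqE.
Qed.

(** In the sum of [deg_mono] over all vertices, edges inside the star count twice from within, and
    edges leaving it once from each side. Together they give twice [view_mono], so the remaining
    outside sum is even and its half is exact. *)
Lemma mono_edges_recolor :
  mono_edges s' = (mono_outside + view_mono (star_view s) c c1 c2 c3)%N.
Proof.
have [sv s1 s2 s3 out] := recolor_starE s c c1 c2 c3.
have [a0 a1 a2 a3] := adj_v; have [b1 b2 b3] := adj_v'.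
have := sum_deg_mono s'; rewrite sum_star.
have -> : (\sum_(x | x \notin C) deg_mono s' x =
    \sum_(x | x \notin C) \sum_(y | y \notin C) (adj x y && (s x == s y))
    + count_mem (c1 : nat) (outer_colors s u1)
    + count_mem (c2 : nat) (outer_colors s u2)
    + count_mem (c3 : nat) (outer_colors s u3))%N.
  under eq_bigr => x _ do rewrite deg_monoE sum_star.
  rewrite !big_split /=.
  have h u : (\sum_(x | x \notin C) (adj x u && (s' x == s' u)) =
      count_mem (s' u : nat) (outer_colors s u))%N.
    by rewrite -mono_outer; apply: eq_bigr => x _; rewrite adj_sym eq_sym.
  rewrite !h /s' sv s1 s2 s3 {1}/outer_colors outer_v /= add0n.
  rewrite addnC !addnA; do !congr (_ + _)%N.
  by apply: eq_bigr => x xC; apply: eq_bigr => y yC; rewrite !out.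
have h u : deg_mono s' u = (
    (adj u v && (s' u == c)) + (adj u u1 && (s' u == c1))
    + (adj u u2 && (s' u == c2)) + (adj u u3 && (s' u == c3))
    + count_mem (s' u : nat) (outer_colors s u))%N.
  by rewrite deg_monoE sum_star mono_outer /s' sv s1 s2 s3.
rewrite deg_mono_center !h b1 b2 b3 !adj_irrefl.
rewrite (adj_sym u2 u1) (adj_sym u3 u1) (adj_sym u3 u2) /s' s1 s2 s3 /=.
rewrite /center_mono -!(val_eqE (_ : 'I_q)) /= (eq_sym (c2 : nat) c1)
  (eq_sym (c3 : nat) c1) (eq_sym (c3 : nat) c2).
have -> : mono_outside = (\sum_(x | x \notin C) \sum_(y | y \notin C)
  (adj x y && (s x == s y)))./2 by [].
move: (\sum_(x | x \notin C) _)%N (mono_edges _) => A m.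
do ![move: (nat_of_bool _) => ?]; do ![move: (count_mem _ _) => ?].
by clear; lia.
Qed.

Lemma const_nbhdE (t : {ffun G -> 'I_q}) x d y0 : adj x y0 -> t y0 = d ->
  const_nbhd t x = [forall y, adj x y ==> (t y == d)].
Proof.
move=> xy0 <-; apply/forallP/forallP => [h y|h y].
  apply/implyP => xy; have /forallP/(_ y0) := h y.
  by rewrite xy xy0.
apply/forallP => z; apply/implyP => /andP[xy xz].
by rewrite (eqP (implyP (h y) xy)) (eqP (implyP (h z) xz)).
Qed.

Let forall_star (p : pred G) :
  [forall y, p y] = [&& p v, p u1, p u2, p u3 & [forall (y | y \notin C), p y]].
Proof.
apply/forallP/and5P => [h|[pv p1 p2 p3 /forall_inP h] y].
  by split=> //; apply/forall_inP.
by case: (boolP (y \in C)) => [|/h //]; rewrite !inE => /or4P[] /eqP->.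
Qed.

Let const_outer u (d : 'I_q) :
  [forall (y | y \notin C), adj u y ==> (s' y == d)] =
  all (pred1 (d : nat)) (outer_colors s u).
Proof.
have [_ _ _ _ out] := recolor_starE s c c1 c2 c3.
rewrite all_map; apply/forall_inP/allP => [h y|h y yC].
  rewrite mem_filter => /andP[/andP[uy yC] _] /=.
  by have := implyP (h y yC) uy; rewrite /s' out.
apply/implyP => uy; rewrite /s' out //.
by apply: (h y); rewrite mem_filter uy yC mem_enum.
Qed.

Let const_star u (d : 'I_q) :
  [forall y, adj u y ==> (s' y == d)] =
  [&& adj u v ==> (c == d), adj u u1 ==> (c1 == d), adj u u2 ==> (c2 == d),
      adj u u3 ==> (c3 == d) & all (pred1 (d : nat)) (outer_colors s u)].
Proof.
have [sv s1 s2 s3 _] := recolor_starE s c c1 c2 c3.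
by rewrite forall_star const_outer /s' sv s1 s2 s3.
Qed.

Lemma const_nbhd_center : const_nbhd s' v = center_const c1 c2 c3 :> nat.
Proof.
have [sv s1 s2 s3 _] := recolor_starE s c c1 c2 c3.
have [a0 a1 a2 a3] := adj_v.
rewrite (const_nbhdE a1 s1) const_star /outer_colors outer_v /=.
rewrite a0 a1 a2 a3 /= eqxx andbT /center_const.
by rewrite (eq_sym c2) (eq_sym c3) -!val_eqE.
Qed.

Lemma sum_const_nbhd :
  (\sum_(u | adj v u) const_nbhd s' u = nbr_const (star_view s) c c1 c2 c3)%N.
Proof.
have [sv s1 s2 s3 _] := recolor_starE s c c1 c2 c3.
have [b1 b2 b3] := adj_v'.
have -> : (\sum_(u | adj v u) const_nbhd s' u =
   \sum_(u <- [:: u1; u2; u3]) const_nbhd s' u)%N.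
  rewrite [RHS]big_uniq /=; first by apply: eq_bigl => u; rewrite Nv.
  by move: C_uniq => /= /andP[].
rewrite !big_cons big_nil addn0 addnA.
rewrite (const_nbhdE b1 sv) (const_nbhdE b2 sv) (const_nbhdE b3 sv).
rewrite !const_star !adj_irrefl b1 b2 b3 /= !eqxx.
by rewrite (adj_sym u2 u1) (adj_sym u3 u1) (adj_sym u3 u2).
Qed.

End Recolored.
End StarView.

Definition nbr (G : sgraph) (v : G) (i : nat) : G :=
  nth v (enum [set w | adj v w]) i.

Definition vertex_view (G : sgraph) (q : nat) (v : G) (s : {ffun G -> 'I_q}) :=
  star_view v (nbr v 0) (nbr v 1) (nbr v 2) s.

Lemma nbrP (G : sgraph) (v : G) : cubic G ->
  uniq [:: v; nbr v 0; nbr v 1; nbr v 2] /\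
  forall y, adj v y = (y \in [:: nbr v 0; nbr v 1; nbr v 2]).
Proof.
move=> /(_ v); rewrite cardE /nbr.
have : uniq (enum [set w | adj v w]) by apply: enum_uniq.
have : forall y, (y \in enum [set w | adj v w]) = adj v y.
  by move=> y; rewrite mem_enum inE.
case: (enum _) => [|u1 [|u2 [|u3 [|]]]] //= mem_e u_e _; split=> [|y].
  by rewrite u_e andbT mem_e adj_irrefl.
by rewrite mem_e.
Qed.

(** * Averaging over colorings and vertices *)

Section VertexSum.
Variables (R : realFieldType) (q : nat) (e D B Gam : R) (tight : view -> bool).
Hypotheses (q_gt0 : (0 < q)%N) (e_gt0 : 0 < e).
Hypothesis view_sign : forall V,
  view_wf V -> all (fun c => c < q)%N (view_colors V) ->
  sign_ok (tight V) (view_sum q e D Gam B V).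
Variable G : sgraph.
Hypothesis G3 : cubic G.

Definition vertex_term (v : G) (s : {ffun G -> 'I_q}) : R :=
  D * (deg_mono s v)%:R
  + Gam * (3 * (const_nbhd s v)%:R - \sum_(u | adj v u) (const_nbhd s u)%:R)
  - B.

Definition vertex_sum (v : G) : R :=
  \sum_s e^-1 ^+ mono_edges s * vertex_term v s.

(** Resampling v and its three neighbors costs a factor q each. The weight then splits into an
    outside part, fixed during the resampling, and a part seen in the view; the extra 9 undoes the
    scaling in [view_weight]. *)
Lemma vertex_sumE v :
  q%:R ^+ 4 * vertex_sum v =
  \sum_(s : {ffun G -> 'I_q})
     e^-1 ^+ (mono_outside v (nbr v 0) (nbr v 1) (nbr v 2) s + 9) *
     view_sum q e D Gam B (vertex_view v s).
Proof.
have [C_uniq Nv] := nbrP v G3.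
rewrite !(exprS q%:R) expr0 mulr1 -!mulrA /vertex_sum.
(* The last neighbor goes first, so that the nested recolorings come out in the order of
   [recolor_star]. *)
rewrite -(sum_recolor _ (nbr v 2)) -(sum_recolor _ (nbr v 1)).
rewrite -(sum_recolor _ (nbr v 0)) -(sum_recolor _ v).
apply: eq_bigr => s _; rewrite /view_sum /= big_mkord mulr_sumr.
apply: eq_bigr => c _; rewrite big_mkord mulr_sumr.
apply: eq_bigr => c1 _; rewrite big_mkord mulr_sumr.
apply: eq_bigr => c2 _; rewrite big_mkord mulr_sumr.
apply: eq_bigr => c3 _; rewrite -/(recolor_star _ _ _ _ s c c1 c2 c3).
rewrite (mono_edges_recolor C_uniq Nv) exprD [in RHS]exprD.
rewrite -[LHS]mulrA -[RHS]mulrA; congr (_ * _).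
rewrite /vertex_term (deg_mono_center C_uniq Nv) (const_nbhd_center C_uniq Nv).
rewrite -natr_sum (sum_const_nbhd C_uniq Nv).
have m9 := view_mono_le9 C_uniq Nv G3 s c c1 c2 c3.
set m := view_mono _ _ _ _ _; move: (D * _ + _ - B) => t.
have wE : e^-1 ^+ 9 * e ^+ (9 - m) = e^-1 ^+ m.
  rewrite -{1}(subnK m9) exprD mulrAC -exprMn mulVf ?gt_eqF //.
  by rewrite expr1n mul1r.
by rewrite -wE -[LHS]mulrA.
Qed.

(** By [vertex_sumE] a positive multiple of the sum is a combination, with positive weights, of
    nonnegative view sums; it vanishes only if each of them does, and these range over all
    colorings. *)
Lemma vertex_sum_sign v :
  0 <= vertex_sum v /\
  (vertex_sum v = 0 <-> forall s : {ffun G -> 'I_q}, tight (vertex_view v s)).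
Proof.
have [C_uniq Nv] := nbrP v G3.
have q4 : 0 < q%:R ^+ 4 :> R by rewrite exprn_gt0 // ltr0n.
have w_gt0 n : 0 < e^-1 ^+ n by rewrite exprn_gt0 // invr_gt0.
have S_sign (s : {ffun G -> 'I_q}) : sign_ok (tight (vertex_view v s))
    (view_sum q e D Gam B (vertex_view v s)).
  by apply: view_sign; [apply: star_view_wf | apply: star_view_lt].
have S_ge0 (s : {ffun G -> 'I_q}) : 0 <= view_sum q e D Gam B (vertex_view v s).
  by have := S_sign s; case: (tight _) => /= [->|/ltW].
have T_ge0 (s : {ffun G -> 'I_q}) : 0 <=
    e^-1 ^+ (mono_outside v (nbr v 0) (nbr v 1) (nbr v 2) s + 9) *
     view_sum q e D Gam B (vertex_view v s).
  by rewrite mulr_ge0 // ltW.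
split; first by rewrite -(pmulr_rge0 _ q4) vertex_sumE sumr_ge0.
have -> : (vertex_sum v = 0) <-> (q%:R ^+ 4 * vertex_sum v = 0).
  split=> [->|/eqP]; first by rewrite mulr0.
  by rewrite mulf_eq0 gt_eqF //= => /eqP.
rewrite vertex_sumE; split=> [/psumr_eq0P h s|h].
  have := h (fun s _ => T_ge0 s) s isT => /eqP.
  rewrite mulf_eq0 gt_eqF //= => /eqP S0; have := S_sign s.
  by case: (tight _) => //=; rewrite S0 ltxx.
apply: big1 => s _; have := S_sign s; rewrite h /= => ->.
by rewrite mulr0.
Qed.

(** The [Gam] terms cancel by [cubic_double_count]; the factor 2 is the handshake count. *)
Lemma sum_vertex_sum :
  \sum_v vertex_sum v =
  2 * D * \sum_(s : {ffun G -> 'I_q}) (mono_edges s)%:R * e^-1 ^+ mono_edges s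
  - #|G|%:R * B * \sum_(s : {ffun G -> 'I_q}) e^-1 ^+ mono_edges s.
Proof.
rewrite exchange_big !mulr_sumr -sumrB; apply: eq_bigr => s _ /=.
rewrite -mulr_sumr /vertex_term !big_split /= -!mulr_sumr sumrN.
rewrite sumrB -mulr_sumr cubic_double_count // -natr_sum sum_deg_mono.
rewrite sumr_const -mulr_natl -muln2 natrM.
move: (e^-1 ^+ _) (_ s)%:R => w m.
ring.
Qed.

End VertexSum.

Section EnergyBound.
Variables (R : realType) (q : nat) (beta D B Gam : R) (tight : view -> bool).
Hypothesis q_gt0 : (0 < q)%N.
Hypothesis view_sign : forall V,
  view_wf V -> all (fun c => c < q)%N (view_colors V) ->
  sign_ok (tight V) (view_sum q (expR beta) D Gam B V).

(** The sum of all vertex sums is |G| Z (2 D U - B), with U the energy and |G| Z positive. No sign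
    of D is assumed, so both bounds are instances. *)
Lemma energy_bound (G : sgraph) : (0 < #|G|)%N -> cubic G ->
  B <= 2 * D * internal_energy q G beta /\
  (2 * D * internal_energy q G beta = B <->
   forall (v : G) (s : {ffun G -> 'I_q}), tight (vertex_view v s)).
Proof.
move=> G_gt0 G3; have e_gt0 : 0 < expR beta by apply: expR_gt0.
have := @vertex_sum_sign R q (expR beta) D B Gam tight q_gt0 e_gt0 view_sign
  G G3.
have := sum_vertex_sum q (expR beta) D B Gam G3.
set S := @vertex_sum _ _ _ _ _ _ G => sumS signS.
have wE n : (expR beta)^-1 ^+ n = expR (- beta * n%:R).
  by rewrite -expRN -expRM_natr.
have Z_gt0 := potts_Z_gt0 G beta q_gt0.
have n_gt0 : 0 < #|G|%:R :> R by rewrite ltr0n.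
have {}sumS : \sum_v S v = #|G|%:R * potts_Z q G beta *
    (2 * D * internal_energy q G beta - B).
  rewrite sumS internal_energyE //.
  under eq_bigr do rewrite wE.
  under [X in _ - _ * X]eq_bigr do rewrite wE.
  rewrite -/(potts_Z q G beta); field.
  by rewrite !gt_eqF.
have S_ge0 v : 0 <= S v by case: (signS v).
split.
  rewrite -subr_ge0 -(pmulr_rge0 _ (mulr_gt0 n_gt0 Z_gt0)) -sumS.
  exact: sumr_ge0.
have -> : (2 * D * internal_energy q G beta = B) <-> (\sum_v S v = 0).
  rewrite sumS; split=> [->|/eqP]; first by rewrite subrr mulr0.
  by rewrite mulf_eq0 gt_eqF ?mulr_gt0 //= subr_eq0 => /eqP.
split=> [/psumr_eq0P h v|h].
  by apply/(signS v).2/h.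
by apply: big1 => v _; apply/(signS v).2/h.
Qed.

End EnergyBound.

(** * Extremal graphs *)

Definition twin_nbrs (G : sgraph) : Prop :=
  forall v u u' : G, adj v u -> adj v u' -> forall y, adj u y = adj u' y.

Definition clique_nbrs (G : sgraph) : Prop :=
  forall v u u' : G, adj v u -> adj v u' -> u != u' -> adj u u'.

(** Tightness depends on the adjacencies alone here, so one constant coloring detects it. *)
Lemma clique_nbrsP (G : sgraph) (q : nat) : cubic G -> (0 < q)%N ->
  (forall (v : G) (s : {ffun G -> 'I_q}), K4_view (vertex_view v s)) <->
  clique_nbrs G.
Proof.
move=> G3 q_gt0; split=> [h v u u'|h v s].
  have [_ Nv] := nbrP v G3; have := h v [ffun=> Ordinal q_gt0].
  rewrite /= => /and3P[a12 a13 a23]; rewrite !Nv !inE.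
  by case/or3P=> /eqP-> /or3P[] /eqP->; rewrite ?eqxx // => _; rewrite 1?adj_sym.
have [/= /and3P[_ u123 /andP[u23 _]] Nv] := nbrP v G3.
move: u123 u23; rewrite !inE negb_or => /andP[u12 u13] u23.
by apply/and3P; split; apply: (h v); rewrite // Nv !inE eqxx ?orbT.
Qed.

Lemma twin_nbrsP (G : sgraph) (q : nat) : cubic G -> (1 < q)%N ->
  (forall (v : G) (s : {ffun G -> 'I_q}), K33_view (vertex_view v s)) <->
  twin_nbrs G.
Proof.
move=> G3 q_gt1; split=> [h v|h v s]; last first.
  have [_ Nv] := nbrP v G3.
  have N i : (i < 3)%N -> adj v (nbr v i).
    by move: i => [|[|[|//]]] _; rewrite Nv !inE eqxx ?orbT.
  have nadj i j : (i < 3)%N -> (j < 3)%N -> adj (nbr v i) (nbr v j) = false.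
    by move=> /N vi /N vj; rewrite (h v _ _ vi vj) adj_irrefl.
  have eq_col i j : (i < 3)%N -> (j < 3)%N ->
    perm_eq (outer_colors v (nbr v 0) (nbr v 1) (nbr v 2) s (nbr v i))
            (outer_colors v (nbr v 0) (nbr v 1) (nbr v 2) s (nbr v j)).
    move=> /N vi /N vj; apply/perm_map; rewrite /outer.
    rewrite (eq_filter (a2 := fun y => adj (nbr v j) y &&
      (y \notin [:: v; nbr v 0; nbr v 1; nbr v 2]))) // => y.
    by rewrite (h v _ _ vi vj).
  by rewrite /vertex_view /star_view /K33_view !nadj // !eq_col.
have [C_uniq Nv] := nbrP v G3.
pose N := [:: nbr v 0; nbr v 1; nbr v 2].
pose oc (s : {ffun G -> 'I_q}) := outer_colors v (nbr v 0) (nbr v 1) (nbr v 2) s.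
have ok u u' : u \in N -> u' \in N ->
    ~~ adj u u' /\ forall s, perm_eq (oc s u) (oc s u').
  move=> uN u'N; have q_gt0 : (0 < q)%N by apply: ltn_trans q_gt1.
  split=> [|s].
    have /and5P[a12 a13 a23 _ _] := h v [ffun=> Ordinal q_gt0].
    move: uN u'N; rewrite !inE.
    by case/or3P=> /eqP-> /or3P[] /eqP->; rewrite ?adj_irrefl // 1?adj_sym.
  have /and5P[_ _ _ p12 p23] := h v s.
  have h1 w : w \in N -> perm_eq (oc s w) (oc s (nbr v 0)).
    rewrite !inE => /or3P[] /eqP->; rewrite ?perm_refl //.
      by rewrite perm_sym.
    by rewrite perm_sym; apply: perm_trans p12 p23.
  by apply: perm_trans (h1 _ uN) _; rewrite perm_sym h1.
have sub u u' y : u \in N -> u' \in N -> adj u' y -> adj u y.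
  move=> uN u'N u'y.
  case: (eqVneq y v) => [->|yv]; first by rewrite adj_sym Nv.
  case: (boolP (y \in N)) => yN; first by have [] := ok _ _ u'N yN; rewrite u'y.
  (* Two colors mark the neighborhood of u. All outer neighbors of u then get color 1, and as u'
     sees the same colors, so does y; hence y is adjacent to u. *)
  pose s : {ffun G -> 'I_q} :=
    [ffun z => if adj u z then Ordinal q_gt1 else Ordinal (ltnW q_gt1)].
  have : (s y : nat) \in oc s u'.
    by apply: map_f; rewrite mem_filter u'y mem_enum in_cons negb_or yv yN.
  have [_ /(_ s)/perm_mem <-] := ok _ _ uN u'N.
  case/mapP=> z; rewrite mem_filter !ffunE => /andP[/andP[-> _] _].
  by case: (adj u y).
move=> u u' vu vu' y; move: vu vu'; rewrite !Nv => uN u'N.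
by apply/idP/idP; apply: sub.
Qed.

Lemma twin_nbrs_complete_bipartite m n : twin_nbrs (complete_bipartite m n).
Proof. by case=> [i|i] [j|j] // [k|k] // _ _ []. Qed.

Lemma clique_nbrs_complete n : clique_nbrs (complete n).
Proof. by []. Qed.

Lemma cubic_K33 : cubic (complete_bipartite 3 3).
Proof.
case=> i; rewrite -sum1_card big_mkcond big_sumType /=.
  rewrite big1 => [|j _]; last by rewrite inE.
  rewrite -big_mkcond /= (eq_bigl predT) ?sum1_card ?card_ord // => j.
  by rewrite inE.
rewrite [X in (_ + X)%N]big1 => [|j _]; last by rewrite inE.
rewrite -big_mkcond /= (eq_bigl predT) ?sum1_card ?card_ord // => j.
by rewrite inE.
Qed.

Lemma cubic_K4 : cubic (complete 4).
Proof.
move=> i; rewrite (_ : [set j | adj i j] = [set~ i]) ?cardsC1 ?card_ord //.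
by apply/setP => j; rewrite !inE eq_sym.
Qed.

Lemma twin_nbrs_copies (G H : sgraph) :
  twin_nbrs H -> disjoint_union_of_copies H G -> twin_nbrs G.
Proof.
move=> hH [k [f _ fE]] v u u'; rewrite -!fE.
move=> /andP[/eqP vu1 vu2] /andP[/eqP vu'1 vu'2] y.
by rewrite -!fE /= /copies_adj -vu1 -vu'1 (hH _ _ _ vu2 vu'2).
Qed.

Lemma clique_nbrs_copies (G H : sgraph) :
  clique_nbrs H -> disjoint_union_of_copies H G -> clique_nbrs G.
Proof.
move=> hH [k [f f_bij fE]] v u u'; rewrite -!fE.
move=> /andP[/eqP vu1 vu2] /andP[/eqP vu'1 vu'2] uNu'.
rewrite /= /copies_adj -vu1 -vu'1 eqxx (hH _ _ _ vu2 vu'2) //.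
apply: contraNneq uNu' => u2; apply/eqP/(bij_inj f_bij).
by rewrite [f u]surjective_pairing [f u']surjective_pairing -vu1 -vu'1 u2.
Qed.

(* A graph whose vertices are sorted into classes r, in each of which h is an
   isomorphism onto H, is a disjoint union of copies of H. *)
Lemma copies_of_classes (G H : sgraph) (T : finType) (r : G -> T) (h : G -> H) :
  (forall x y, adj x y -> r x = r y) ->
  (forall x y, r x = r y -> adj (h x) (h y) = adj x y) ->
  (forall x y, r x = r y -> h x = h y -> x = y) ->
  (forall x z, exists2 y, r y = r x & h y = z) ->
  disjoint_union_of_copies H G.
Proof.
move=> r_adj h_adj h_inj h_surj; pose A := r @: [set: G].
have rA x : r x \in A by apply: imset_f.
exists #|A|; pose f x := (enum_rank_in (rA x) (r x), h x).
have rankE x y : (enum_rank_in (rA x) (r x) == enum_rank_in (rA y) (r y)) =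
    (r x == r y).
  apply/eqP/eqP => [E|E]; last first.
    apply: enum_val_inj; rewrite !enum_rankK_in //.
  by rewrite -(enum_rankK_in (rA x) (rA x)) E enum_rankK_in.
exists f => [|x y]; last first.
  rewrite /= /copies_adj /f /= rankE; case: eqP => [/h_adj -> //|E].
  by apply/esym/negbTE/negP => /r_adj.
pose g (p : 'I_#|A| * H) : option G := [pick y | f y == p].
have f_inj : injective f.
  move=> x y fxy; have /eqP := congr1 fst fxy; rewrite rankE => /eqP rxy.
  exact: h_inj rxy (congr1 snd fxy).
(* Bijectivity follows by counting: h maps each class bijectively onto H, so G has as many vertices
   as the copies. *)
apply: inj_card_bij f_inj _.
rewrite card_prod card_ord.
suff -> : (#|G| = \sum_(a in A) #|H|)%N by rewrite sum_nat_const.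
rewrite -sum1_card (partition_big r (mem A)) //=.
apply: eq_bigr => _ /imsetP[x _ ->]; rewrite sum1_card.
have h_on : {in [pred y | r y == r x] &, injective h}.
  by move=> y z /eqP yx /eqP zx; apply: h_inj; rewrite yx zx.
rewrite -(card_in_image h_on); apply: eq_card => z.
have [y yx <-] := h_surj x z; rewrite inE.
by apply/mapP; exists y => //; rewrite mem_enum inE yx.
Qed.

(** The classes are the closed neighborhoods: adjacent vertices share theirs, each has four
    elements, and any enumeration of one is an isomorphism onto K_4. *)
Lemma clique_nbrs_K4 (G : sgraph) : cubic G -> clique_nbrs G ->
  disjoint_union_of_copies (complete 4) G.
Proof.
move=> G3 cl; pose r (x : G) := [set y | (y == x) || adj x y].
have r_card x : #|r x| = 4.
  have -> : r x = x |: [set y | adj x y] by apply/setP => y; rewrite !inE.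
  by rewrite cardsU1 G3 inE adj_irrefl.
have r_adj x y : adj x y -> r x = r y.
  move=> xy; apply/setP => z; rewrite !inE.
  have cl' (a b c : G) : adj a b -> (c == a) || adj a c -> (c == b) || adj b c.
    move=> ab /orP[/eqP->|ac]; first by rewrite adj_sym ab orbT.
    by case: (eqVneq c b) => //= cb; apply: (cl a); rewrite // eq_sym.
  by apply/idP/idP; apply: cl' => //; rewrite adj_sym.
have r_refl x : x \in r x by rewrite inE eqxx.
have adjE x y : r x = r y -> adj x y = (x != y).
  move=> rxy; have := r_refl y; rewrite -rxy inE eq_sym.
  by case: eqP => [->|_ /= ->] //=; rewrite adj_irrefl.
pose h x : 'I_4 := inord (index x (enum (r x))).
have hE x : h x = index x (enum (r x)) :> nat.
  have : (index x (enum (r x)) < #|r x|)%N by rewrite cardE index_mem mem_enum.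
  by rewrite r_card; apply: inordK.
have h_inj x y : r x = r y -> h x = h y -> x = y.
  move=> rxy hxy; have := congr1 val hxy; rewrite /= !hE rxy.
  have xr : x \in enum (r y) by rewrite mem_enum -rxy.
  have yr : y \in enum (r y) by rewrite mem_enum.
  exact: index_inj.
apply: (@copies_of_classes _ (complete 4) _ r h) => // [x y rxy|x z].
  rewrite adjE //= /complete_adj; congr (~~ _).
  by apply/eqP/eqP => [/h_inj ->|->].
pose y := nth x (enum (r x)) z.
have z_lt : (z < size (enum (r x)))%N by rewrite -cardE r_card.
have yx : r y = r x.
  have : y \in r x by rewrite -mem_enum mem_nth.
  by rewrite inE => /orP[/eqP->|/r_adj ->].
exists y => //; apply: val_inj; rewrite /= hE yx.
by rewrite index_uniq ?enum_uniq.
Qed.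

(** Along an edge xu the neighbors of u are exactly the twins of x, and conversely. So [N x] and
    [T x] are the two sides, of size 3, of a copy of K_{3,3}, and their union is the class of x. *)
Lemma twin_nbrs_K33 (G : sgraph) : cubic G -> twin_nbrs G ->
  disjoint_union_of_copies (complete_bipartite 3 3) G.
Proof.
move=> G3 tw; pose N (x : G) := [set y | adj x y].
pose T (x : G) := [set y | N y == N x].
have N0 (x : G) : exists u, adj x u.
  have : (0 < #|N x|)%N by rewrite G3.
  by case/card_gt0P => u; rewrite inE; exists u.
have NT (x u : G) : adj x u -> N u = T x.
  move=> xu; apply/setP => y; rewrite !inE; apply/idP/eqP => [uy|/setP/(_ u)].
    by apply/setP => z; rewrite !inE (tw u y x) // adj_sym.
  by rewrite !inE xu adj_sym.
have TN (x u : G) : adj x u -> T u = N x by move=> xu; rewrite (NT u) // adj_sym.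
have T_card x : #|T x| = 3 by have [u xu] := N0 x; rewrite -(NT x u) ?G3.
have T_refl x : x \in T x by rewrite inE.
have T_eq x y : y \in T x -> N y = N x /\ T y = T x.
  by rewrite inE => /eqP E; split=> //; apply/setP => z; rewrite !inE E.
have NT_disj x : N x != T x.
  by apply/eqP => /setP/(_ x); rewrite T_refl inE adj_irrefl.
pose r x := N x :|: T x.
have r_adj (x y : G) : adj x y -> r x = r y.
  by move=> xy; rewrite /r (NT x y) // (TN x y) // finset.setUC.
have r_refl x : x \in r x by rewrite in_setU T_refl orbT.
have r_cases x y : r x = r y ->
    (N y = N x /\ T y = T x) \/ (N y = T x /\ T y = N x).
  move=> rxy; have := r_refl y; rewrite -rxy in_setU.
  case/orP=> [|/T_eq]; last by left.
  by rewrite inE => xy; right; rewrite (NT x y) // (TN x y).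
(* One vertex depending only on the class is needed to tell its two sides apart consistently; the
   default is not reached, the class being non-empty. *)
pose base x := head x (enum (r x)).
have baseE x y : r x = r y -> base x = base y.
  rewrite /base => <-; have := r_refl x; rewrite -mem_enum.
  by case: (enum (r x)).
have base_in x : base x \in r x.
  rewrite /base -mem_enum; have := r_refl x; rewrite -mem_enum.
  by case: (enum (r x)) => //= a l _; rewrite mem_head.
pose side x := base x \in T x.
have sideE x y : r x = r y -> (side x == side y) = (T x == T y).
  move=> rxy; rewrite /side -(baseE _ _ rxy); have := base_in x.
  have [[_ ->]|[_ ->]] := r_cases x y rxy; first by rewrite !eqxx.
  rewrite in_setU [T x == _]eq_sym (negbTE (NT_disj x)).
  have : ~~ ((base x \in N x) && (base x \in T x)).
    apply/negP => /andP[]; rewrite inE => xb /T_eq[_ Tb].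
    by have := NT_disj x; rewrite -(TN _ _ xb) Tb eqxx.
  by case: (_ \in N x); case: (_ \in T x).
pose i x : 'I_3 := inord (index x (enum (T x))).
have iE x : i x = index x (enum (T x)) :> nat.
  have : (index x (enum (T x)) < #|T x|)%N by rewrite cardE index_mem mem_enum.
  by rewrite T_card; apply: inordK.
pose h x : 'I_3 + 'I_3 := if side x then inl (i x) else inr (i x).
have h_side x y : h x = h y -> side x = side y /\ i x = i y.
  by rewrite /h; case: (side x); case: (side y) => // -[].
apply: (@copies_of_classes _ (complete_bipartite 3 3) _ r h) => //.
- move=> x y rxy.
  have -> : adj x y = (T x != T y).
    have [[Ny Ty]|[Ny Ty]] := r_cases x y rxy.
      rewrite Ty eqxx; apply/negP => xy.
      by have := NT_disj x; rewrite -(TN x y) // Ty eqxx.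
    rewrite Ty eq_sym NT_disj; have := T_refl y; rewrite Ty inE.
    by [].
  rewrite -sideE // /h; by case: (side x); case: (side y).
- move=> x y rxy /h_side[/eqP]; rewrite sideE // => /eqP Txy ixy.
  have := congr1 val ixy; rewrite /= !iE Txy.
  have xr : x \in enum (T y) by rewrite mem_enum -Txy.
  have yr : y \in enum (T y) by rewrite mem_enum.
  exact: index_inj.
have pick x (j : 'I_3) : exists2 y, r y = r x & side y = side x /\ i y = j.
  pose y := nth x (enum (T x)) j.
  have j_lt : (j < size (enum (T x)))%N by rewrite -cardE T_card.
  have /T_eq[Ny Ty] : y \in T x by rewrite -mem_enum mem_nth.
  have ryx : r y = r x by rewrite /r Ny Ty.
  exists y => //; split; first by apply/eqP; rewrite sideE // Ty.
  by apply: val_inj; rewrite /= iE Ty index_uniq ?enum_uniq.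
move=> x z; have [x' rx' sx'] : exists2 x', r x' = r x &
    side x' = if z is inl _ then true else false.
  (* If x lies on the wrong side, any neighbor of it lies on the required one. *)
  have [u xu] := N0 x; have rxu := r_adj _ _ xu.
  have sxu : side x != side u by rewrite sideE // (TN x u) // eq_sym NT_disj.
  case: z => z; case: (boolP (side x)) => sx.
  - by exists x.
  - by exists u => //; move: sxu; rewrite (negbTE sx); case: (side u).
  - by exists u => //; move: sxu; rewrite sx; case: (side u).
  - by exists x => //; apply: negbTE.
pose j := match z with inl j => j | inr j => j end.
have [y ry [sy iy]] := pick x' j; exists y; first by rewrite ry.
by rewrite /h sy sx' iy /j; case: z {sx' j iy}.
Qed.

(** * Energies *)

Section Energy.
Variables (R : realType) (q : nat).
Hypothesis q_ge2 : (2 <= q)%N.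

Let q_gt0 : (0 < q)%N. Proof. exact: ltnW. Qed.

(** All views of K_{3,3} are tight, so the bound applied to K_{3,3} itself gives its energy as B /
    (2 D), without computing its partition function. *)
Lemma K33_energy (G : sgraph) (beta : R) : (0 < #|G|)%N -> cubic G -> 0 < beta ->
  let K33 := complete_bipartite 3 3 in
  internal_energy q K33 beta <= internal_energy q G beta /\
  (internal_energy q K33 beta = internal_energy q G beta <->
   disjoint_union_of_copies K33 G).
Proof.
move=> G_gt0 G3 beta_gt0 K33; have e_gt1 : 1 < expR beta by rewrite expR_gt1.
have bound := energy_bound q_gt0 (K33_view_sum_sign q_ge2 e_gt1).
have [G_le G_eq] := bound G G_gt0 G3.
have D_gt0 : 0 < 2 * K33_Z q%:R (expR beta).
  by rewrite mulr_gt0 // K33_Z_gt0.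
have K33_gt0 : (0 < #|K33|)%N by rewrite card_sum !card_ord.
have K33_eq := (bound K33 K33_gt0 cubic_K33).2.2
  ((twin_nbrsP cubic_K33 q_ge2).2 (@twin_nbrs_complete_bipartite 3 3)).
split; first by rewrite -(ler_pM2l D_gt0) K33_eq.
split=> [E|].
  apply/(twin_nbrs_K33 G3)/(twin_nbrsP G3 q_ge2)/G_eq.
  by rewrite -E.
move/(twin_nbrs_copies (@twin_nbrs_complete_bipartite 3 3)).
move/(twin_nbrsP G3 q_ge2)/G_eq => E.
by apply: (mulfI (lt0r_neq0 D_gt0)); rewrite E.
Qed.

Lemma K4_energy (G : sgraph) (beta : R) : (0 < #|G|)%N -> cubic G -> 0 < beta ->
  let K4 := complete 4 in
  internal_energy q G beta <= internal_energy q K4 beta /\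
  (internal_energy q G beta = internal_energy q K4 beta <->
   disjoint_union_of_copies K4 G).
Proof.
move=> G_gt0 G3 beta_gt0 K4; have e_gt1 : 1 < expR beta by rewrite expR_gt1.
have bound := energy_bound q_gt0 (K4_view_sum_sign q_ge2 e_gt1).
have [G_le G_eq] := bound G G_gt0 G3.
(* Cancelling a negative factor reverses the inequality and yields the upper bound. *)
have D_lt0 : 2 * - K4_Z q%:R (expR beta) < 0.
  by rewrite mulrN oppr_lt0 mulr_gt0 // K4_Z_gt0.
have K4_gt0 : (0 < #|K4|)%N by rewrite card_ord.
have K4_eq := (bound K4 K4_gt0 cubic_K4).2.2
  ((clique_nbrsP cubic_K4 q_gt0).2 (@clique_nbrs_complete 4)).
split; first by rewrite -(ler_nM2l D_lt0) K4_eq.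
split=> [E|].
  apply/(clique_nbrs_K4 G3)/(clique_nbrsP G3 q_gt0)/G_eq.
  by rewrite E.
move/(clique_nbrs_copies (@clique_nbrs_complete 4)).
move/(clique_nbrsP G3 q_gt0)/G_eq => E.
by apply: (mulfI (ltr0_neq0 D_lt0)); rewrite E.
Qed.

Lemma is_derive_free_energy (G : sgraph) (b : R) :
  is_derive b 1 (free_energy q G) (- internal_energy q G b).
Proof.
have h := is_derive1_comp (is_derive1_ln (potts_Z_gt0 G b q_gt0))
  (is_derive_potts_Z q G b).
have -> : internal_energy q G b = - #|G|%:R^-1 *
    'D_1 (fun b : R => ln (potts_Z q G b)) b.
  by rewrite /internal_energy derive1E.
rewrite mulNr opprK.
rewrite (_ : free_energy q G =
  #|G|%:R^-1 \*: (fun b : R => ln (potts_Z q G b))) //.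
have h' : derivable (fun b : R => ln (potts_Z q G b)) b 1 by case: h.
exact: is_deriveZ (DeriveDef h' erefl).
Qed.

Lemma free_energy0 (G : sgraph) : (0 < #|G|)%N ->
  free_energy q G 0 = ln q%:R :> R.
Proof.
move=> G_gt0; rewrite /free_energy /potts_Z.
under eq_bigr do rewrite oppr0 mul0r expR0.
rewrite sumr_const card_ffun card_ord natrX lnXn ?ltr0n //.
by rewrite -[ln _ *+ _]mulr_natl mulKf // pnatr_eq0 -lt0n.
Qed.

(** Free energy has derivative minus the internal energy, and at 0 it equals ln q for every graph.
    So the difference of the free energies starts at 0 and is nonincreasing. *)
Lemma le_free_energy (G H : sgraph) (beta : R) :
  (0 < #|G|)%N -> (0 < #|H|)%N -> 0 < beta ->
  (forall b : R, 0 < b -> internal_energy q G b <= internal_energy q H b) ->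
  free_energy q H beta <= free_energy q G beta.
Proof.
move=> G_gt0 H_gt0 beta_gt0 leU.
pose f : R -> R := free_energy q H - free_energy q G.
have df (b : R) :
    is_derive b 1 f (- internal_energy q H b + internal_energy q G b).
  rewrite -[X in _ + X]opprK.
  apply: is_deriveB; exact: is_derive_free_energy.
have f_le : f beta <= f 0.
  apply: (@ler0_derive1_le_cc _ f 0 beta).
  - by move=> b _; have [] := df b.
  - move=> b; rewrite in_itv /= => /andP[b_gt0 _].
    rewrite derive1E; have [_ ->] := df b.
    by rewrite addrC subr_le0 leU.
  - by apply: derivable_within_continuous => b _; have [] := df b.
  - by rewrite in_itv /= lexx ltW.
  - by rewrite in_itv /= lexx ltW.
  - exact: ltW.
have fE b : f b = free_energy q H b - free_energy q G b by [].
by move: f_le; rewrite !fE !free_energy0 // subrr subr_le0.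
Qed.

End Energy.

Theorem theorem1 (R : realType) (G : sgraph) (q : nat) (beta : R)
    (G_nonempty : (0 < #|G|)%N) (G_cubic : cubic G)
    (q_ge2 : (2 <= q)%N) (beta_gt0 : 0 < beta) :
  let K33 := complete_bipartite 3 3 in
  let K4 := complete 4 in
  [/\ internal_energy q K33 beta <= internal_energy q G beta
        <= internal_energy q K4 beta,
      internal_energy q K33 beta = internal_energy q G beta
        <-> disjoint_union_of_copies K33 G,
      internal_energy q G beta = internal_energy q K4 beta
        <-> disjoint_union_of_copies K4 G
    & free_energy q K4 beta <= free_energy q G beta
        <= free_energy q K33 beta].
Proof.
move=> K33 K4.
have K33_gt0 : (0 < #|K33|)%N by rewrite card_sum !card_ord.
have K4_gt0 : (0 < #|K4|)%N by rewrite card_ord.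
have [K33_le K33_eq] := K33_energy q_ge2 G_nonempty G_cubic beta_gt0.
have [K4_le K4_eq] := K4_energy q_ge2 G_nonempty G_cubic beta_gt0.
split=> //; first by rewrite K33_le.
apply/andP; split.
  apply: (le_free_energy q_ge2 G_nonempty K4_gt0 beta_gt0) => b b_gt0.
  exact: (K4_energy q_ge2 G_nonempty G_cubic b_gt0).1.
apply: (le_free_energy q_ge2 K33_gt0 G_nonempty beta_gt0) => b b_gt0.
exact: (K33_energy q_ge2 G_nonempty G_cubic b_gt0).1.
Qed.
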